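(* Let $\mathfrak g$ be a symmetrizable Kac--Moody superalgebra (as in the context), let $M$ be a highest weight $\mathfrak g$-supermodule and consider the relative Dirac operator $\mathrm D_{\mathfrak g,\mathfrak g_{\bar0}}$ on $M\otimes M(\mathfrak g_{\bar1})$. Then $\ker\mathrm D_{\mathfrak g,\mathfrak g_{\bar0}}$ is a $\mathfrak g_{\bar0}$-module, i.e. it is stable under the diagonal action of $\mathfrak g_{\bar0}$ on $M\otimes M(\mathfrak g_{\bar1})$.
   Context: Kac--Moody superalgebras: for $I=\{1,\dots,n\}$, an $n\times n$ matrix $A=(a_{ij})$ with $a_{ii}\in\{0,2\}$, a parity function $p:I\to\mathbb Z_2$, and $\mathfrak h$ even of dimension $2n-\operatorname{rk}A$ with linearly independent $\alpha_i\in\mathfrak h^*$, $h_i\in\mathfrak h$, $\alpha_j(h_i)=a_{ij}$, let $\mathfrak g(A)$ be the Lie superalgebra generated by $\mathfrak h$ and $X_i,Y_i$ (parity $p(i)$) with $[h,X_i]=\alpha_i(h)X_i$, $[h,Y_i]=-\alpha_i(h)Y_i$, $[X_i,Y_j]=\delta_{ij}h_i$, $[\mathfrak h,\mathfrak h]=0$, modulo the maximal ideal meeting $\mathfrak h$ trivially. It is a Kac--Moody superalgebra if it is quasisimple (every ideal is contained in $\mathfrak h$ or together with $\mathfrak h$ spans), regular ($a_{ij}=0\Rightarrow a_{ji}=0$) and admissible ($a_{ii}=0,p(i)=\bar0\Rightarrow a_{ij}=0\ \forall j$; $a_{ii}=2,p(i)=\bar0\Rightarrow a_{ij}\in\mathbb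 Z_{\le0}$ for $j\ne i$; $a_{ii}=2,p(i)=\bar1\Rightarrow a_{ij}\in2\mathbb Z_{\le0}$ for $j\neq i$); symmetrizable if $DA$ is symmetric for an invertible diagonal $D=\operatorname{diag}(d_i)$, in which case it has the nondegenerate even supersymmetric invariant standard form $B$ with $B(h,h_j)=d_j\alpha_j(h)$. Standing assumption: $B(\alpha,\beta)\in\mathbb R$ for all simple roots. Principal grading: $\deg X_i=1$, $\deg Y_i=-1$, $\deg\mathfrak h=0$. Triangular decomposition $\mathfrak g=\mathfrak n^-\oplus\mathfrak h\oplus\mathfrak n^+$. Weyl vector $\rho\in\mathfrak h^*$: $\rho(h_i)=\tfrac12\alpha_i(h_i)$. Standing assumption for the relative Dirac operator: the Kac--Peterson class of $\mathfrak g_{\bar0}$ is trivial, i.e. there is $\rho_{\bar0}\in\mathfrak h^*$ (extended by zero to root spaces) with $\rho_{\bar0}([x,y])=\tfrac12\operatorname{tr}(\mathrm{ad}_x\pi_-\mathrm{ad}_y\pi_+)-\tfrac12\operatorname{tr}(\mathrm{ad}_y\pi_-\mathrm{ad}_x\pi_+)$ on $\mathfrak g_{\bar0}$, $\pi_\pm$ the projections of $\mathfrak g_{\bar0}$ onto its parts of positive, resp. nonpositive, principal degree. Put $\rho_{\bar1}=\rho_{\bar0}-\rho$. Highest weight supermodule: an $\mathfrak h$-weight supermodule with finite-dimensional weight spaces generated by a nonzero weight vector $v_\Lambda$ with $\mathfrak n^+v_\Lambda=0$. Oscillator module: put $(\mathfrak g_{\bar1})_\pm=\mathfrak g_{\bar1}\cap\mathfrak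 n^\pm$ with bases of root vectors $(x_a)$ of $(\mathfrak g_{\bar1})_-$ and $(\partial_a)$ of $(\mathfrak g_{\bar1})_+$, $B(\partial_a,x_b)=\tfrac12\delta_{ab}$. $\mathrm{Cl}(\mathfrak g_{\bar1})$ (relations $xy-yx=2B(x,y)$) acts on $M(\mathfrak g_{\bar1})=S((\mathfrak g_{\bar1})_-)=\mathbb C[x_1,x_2,\dots]$, $x_a$ by multiplication, $\partial_a$ by $\partial/\partial x_a$. $x\in\mathfrak g_{\bar0}$ acts on $M(\mathfrak g_{\bar1})$ by $\pi(x)=\tfrac12\sum_a{:}[x,x_a]\partial_a{:}-\tfrac12\sum_a{:}[x,\partial_a]x_a{:}-\rho_{\bar1}(x)$, ${:}\ {:}$ placing elements of $(\mathfrak g_{\bar1})_-$ to the left of those of $(\mathfrak g_{\bar1})_+$; $\mathfrak g_{\bar0}$ acts diagonally on $M\otimes M(\mathfrak g_{\bar1})$. The relative Dirac operator on $M\otimes M(\mathfrak g_{\bar1})$ is $\mathrm D_{\mathfrak g,\mathfrak g_{\bar0}}=2\sum_a(x_a\otimes\partial_a-\partial_a\otimes x_a)$ with $(y\otimes z)(v\otimes P)=(-1)^{p(v)}yv\otimes zP$ for $y,z\in\mathfrak g_{\bar1}$ (finitely many nonzero terms on each vector).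
   Formalization: The normalization B(h,h_j)=d_jα_j(h) is replaced by B(h,h_j)=d_j^{-1}α_j(h): with DA symmetric the original formula is in general not symmetric (e.g. for osp(1|4)), so no such form B would exist. *)

(* Defs.v *)
From mathcomp Require Export all_boot all_order all_algebra.
From mathcomp Require Export boolp classical_sets functions cardinality fsbigop.
From mathcomp Require Export reals.
From mathcomp Require Export complex.
From mathcomp Require Export finmap monalg.

Set Implicit Arguments.
Unset Strict Implicit.
Unset Printing Implicit Defensive.

Import Order.TTheory GRing.Theory Num.Theory.
Local Open Scope classical_set_scope.
Local Open Scope ring_scope.

Section LinearAlgebra.
Variables (K : fieldType) (V : lmodType K).

Definition subspace (S : set V) : Prop :=
  S 0 /\ forall (a : K) u v, S u -> S v -> S (a *: u + v).

Definition span_of (S : set V) : set V := smallest subspace S.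

Definition lin_indep (J : eqType) (e : J -> V) : Prop :=
  forall (s : seq J) (c : J -> K), uniq s ->
    \sum_(a <- s) c a *: e a = 0 -> forall a, a \in s -> c a = 0.

Definition basis_family (J : eqType) (S : set V) (e : J -> V) : Prop :=
  lin_indep e /\ span_of (range e) = S.

(* Trace on the possibly infinite-dimensional subspace S of an operator T of
   finite rank on S: c is the matrix of T on a finite-dimensional T-stable
   subspace of S, with basis e, that contains T(S). *)
Definition has_trace (S : set V) (T : V -> V) (t : K) : Prop :=
  exists (m : nat) (e : 'I_m -> V) (c : 'M[K]_m),
    [/\ lin_indep e, (forall i, S (e i)),
        (forall v, S v -> span_of (range e) (T v)),
        (forall j, T (e j) = \sum_i c i j *: e i)
      & t = \tr c].

End LinearAlgebra.

Section Tensor.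
Variables (K : fieldType) (U V : lmodType K).

Definition bilinear_map (W : lmodType K) (f : U -> V -> W) : Prop :=
  (forall u, linear (f u)) /\ (forall v, linear (f^~ v)).

Record tensor_product := TensorProduct {
  tens_sort :> lmodType K;
  tens : U -> V -> tens_sort;
  tens_bilinear : bilinear_map tens;
  tens_universal : forall (W : lmodType K) (f : U -> V -> W), bilinear_map f ->
    exists! F : tens_sort -> W, linear F /\ forall u v, F (tens u v) = f u v }.

Definition tens_lift (T : tensor_product) (W : lmodType K) (f : U -> V -> W) :
    T -> W :=
  xget (fun _ => 0) [set F : T -> W |
    linear F /\ forall u v, F (tens T u v) = f u v].

End Tensor.

(* A superspace is a vector space with the two projections onto its even part
   (index false) and its odd part (index true). *)
Record superspace (K : fieldType) := SuperSpace {
  super_sort :> lmodType K;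
  part : bool -> super_sort -> super_sort;
  part_linear : forall b, linear (part b);
  part_part : forall b c x, part b (part c x) = if b == c then part c x else 0;
  part_sum : forall x, part false x + part true x = x }.

Definition homog (K : fieldType) (V : superspace K) (b : bool) : set V :=
  [set x | part b x = x].
Arguments homog {K} V b.

(* The linear map equal to (-1)^p(v) on homogeneous v. *)
Definition parity_sign (K : fieldType) (V : superspace K) (v : V) : V :=
  part false v - part true v.

Record lieSuperalg (K : fieldType) := LieSuperalg {
  lie_space :> superspace K;
  brk : lie_space -> lie_space -> lie_space;
  brk_bilinear : bilinear_map brk;
  brk_parity : forall a b (x y : lie_space),
    homog _ a x -> homog _ b y -> homog _ (a (+) b) (brk x y);
  brk_antisym : forall a b (x y : lie_space), homog _ a x -> homog _ b y ->
    brk x y = - ((-1) ^+ (a && b) *: brk y x);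
  brk_jacobi : forall a b (x y z : lie_space), homog _ a x -> homog _ b y ->
    brk x (brk y z) = brk (brk x y) z + (-1) ^+ (a && b) *: brk y (brk x z) }.

Notation "[< x , y >]" := (brk x y) (at level 0, format "[<  x ,  y  >]").

Record supermodule (K : fieldType) (g : lieSuperalg K) := SuperModule {
  mod_space :> superspace K;
  act : g -> mod_space -> mod_space;
  act_bilinear : bilinear_map act;
  act_parity : forall a b (x : g) (v : mod_space),
    homog _ a x -> homog _ b v -> homog _ (a (+) b) (act x v);
  act_brk : forall a b (x y : g) (v : mod_space), homog _ a x -> homog _ b y ->
    act [< x, y >] v = act x (act y v) - (-1) ^+ (a && b) *: act y (act x v) }.

Definition lie_morphism (K : fieldType) (g g' : lieSuperalg K) (f : g -> g') :
    Prop :=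
  [/\ linear f, (forall b x, f (part b x) = part b (f x))
    & forall x y, f [< x, y >] = [< f x, f y >]].

Definition lie_subalg (K : fieldType) (g : lieSuperalg K) (S : set g) : Prop :=
  subspace S /\ forall x y, S x -> S y -> S [< x, y >].

Definition lie_ideal (K : fieldType) (g : lieSuperalg K) (S : set g) : Prop :=
  [/\ subspace S, (forall b x, S x -> S (part b x))
    & forall x y, S y -> S [< x, y >]].

(* A realization of A: the space h with the simple roots and the simple
   coroots. *)
Record realization (K : fieldType) (n : nat) (A : 'M[K]_n) := Realization {
  cartan :> vectType K;
  alpha : 'I_n -> 'Hom(cartan, K^o);
  coroot : 'I_n -> cartan;
  cartan_dim : \dim {:cartan} = (2 * n - \rank A)%N;
  alpha_free : free [seq alpha i | i <- enum 'I_n];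
  coroot_free : free [seq coroot i | i <- enum 'I_n];
  alpha_coroot : forall i j, alpha j (coroot i) = A i j }.

Section KacMoody.
Variables (K : fieldType) (n : nat) (A : 'M[K]_n) (p : 'I_n -> bool).
Variable h : realization A.

Record generators (g : lieSuperalg K) := Generators {
  gh : h -> g;
  gX : 'I_n -> g;
  gY : 'I_n -> g }.

Definition chevalley_relations (g : lieSuperalg K) (e : generators g) : Prop :=
  [/\ linear (gh e) /\ (forall u, homog g false (gh e u)),
      (forall i, homog g (p i) (gX e i) /\ homog g (p i) (gY e i)),
      (forall u v, [< gh e u, gh e v >] = 0),
      (forall u i, [< gh e u, gX e i >] = alpha h i u *: gX e i /\
                   [< gh e u, gY e i >] = - (alpha h i u) *: gY e i)
    & (forall i j, [< gX e i, gY e j >] =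
                   if i == j then gh e (coroot h i) else 0)].

Definition maps_generators (g g' : lieSuperalg K) (e : generators g)
    (e' : generators g') (f : g -> g') : Prop :=
  [/\ (forall u, f (gh e u) = gh e' u), (forall i, f (gX e i) = gX e' i)
    & (forall i, f (gY e i) = gY e' i)].

(* (g, e) is the Lie superalgebra presented by the Chevalley generators and
   relations. *)
Definition presented (g : lieSuperalg K) (e : generators g) : Prop :=
  chevalley_relations e /\
  forall (g' : lieSuperalg K) (e' : generators g'), chevalley_relations e' ->
    exists! f : g -> g', lie_morphism f /\ maps_generators e e' f.

Definition meets_cartan_trivially (g : lieSuperalg K) (e : generators g)
    (I : set g) : Prop :=
  forall u, I (gh e u) -> gh e u = 0.

(* (g, e) is g(A): the quotient of the presented Lie superalgebra by its
   largest ideal meeting h trivially. *)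
Definition contragredient (g : lieSuperalg K) (e : generators g) : Prop :=
  exists (gt : lieSuperalg K) (et : generators gt) (q : gt -> g),
    let r := [set x | q x = 0] in
    [/\ presented et, lie_morphism q /\ maps_generators et e q,
        (forall y, exists x, q x = y),
        lie_ideal r /\ meets_cartan_trivially et r
      & forall I, lie_ideal I -> meets_cartan_trivially et I -> I `<=` r].

Definition quasisimple (g : lieSuperalg K) (e : generators g) : Prop :=
  forall I : set g, lie_ideal I ->
    I `<=` range (gh e) \/ forall x, exists2 y, I y & exists u, x = y + gh e u.

Definition regular : Prop := forall i j, A i j = 0 -> A j i = 0.

Definition admissible : Prop :=
  [/\ (forall i, A i i = 0 -> p i = false -> forall j, A i j = 0),
      (forall i, A i i = 2 -> p i = false ->
         forall j, j != i -> exists k : nat, A i j = - k%:R)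
    & (forall i, A i i = 2 -> p i = true ->
         forall j, j != i -> exists k : nat, A i j = - (2 * k)%:R)].

Definition kac_moody (g : lieSuperalg K) (e : generators g) : Prop :=
  [/\ (forall i, A i i = 0 \/ A i i = 2), contragredient e, quasisimple e,
      regular & admissible].

Definition symmetrized_by (d : 'rV[K]_n) : Prop :=
  diag_mx d \in unitmx /\ (diag_mx d *m A)^T = diag_mx d *m A.

Variables (g : lieSuperalg K) (e : generators g).

(* Invariance gives B(h,h_j) = B(X_j,Y_j) alpha_j(h), and the symmetry of
   B(h_i,h_j) = eps_j a_ij for B(X_j,Y_j) = eps_j requires A diag(eps) to be
   symmetric.  When diag(d) A is symmetric, eps_j is therefore d_j^-1 (eps_j
   is the symmetrizing scalar itself in the convention A = diag(eps) S with S
   symmetric). *)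
Definition standard_form (d : 'rV[K]_n) (B : g -> g -> K) : Prop :=
  [/\ bilinear_map (B : g -> g -> K^o),
      (forall x y, homog g false x -> homog g true y ->
         B x y = 0 /\ B y x = 0)
      /\ (forall a b x y, homog g a x -> homog g b y ->
         B x y = (-1) ^+ (a && b) * B y x),
      (forall x y z, B [< x, y >] z = B x [< y, z >]),
      (forall x, (forall y, B x y = 0) -> x = 0)
    & forall u j, B (gh e u) (gh e (coroot h j)) = (d 0 j)^-1 * alpha h j u].

(* The form on h^* transported from the restriction of B to h. *)
Definition cartan_vec (B : g -> g -> K) (l : 'Hom(h, K^o)) : h :=
  xget 0 [set t | forall u, B (gh e t) (gh e u) = l u].

Definition dual_form (B : g -> g -> K) (l m : 'Hom(h, K^o)) : K :=
  B (gh e (cartan_vec B l)) (gh e (cartan_vec B m)).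

Inductive principal : int -> g -> Prop :=
| principal_X i : principal 1 (gX e i)
| principal_Y i : principal (-1) (gY e i)
| principal_h u : principal 0 (gh e u)
| principal_0 k : principal k 0
| principal_lin k a x y :
    principal k x -> principal k y -> principal k (a *: x + y)
| principal_brk j k x y :
    principal j x -> principal k y -> principal (j + k) [< x, y >].

Definition nplus : set g := smallest (@lie_subalg K g) (range (gX e)).
Definition nminus : set g := smallest (@lie_subalg K g) (range (gY e)).

Definition weight_vector (l : 'Hom(h, K^o)) (x : g) : Prop :=
  forall u, [< gh e u, x >] = l u *: x.

Definition cartan_part (x : g) : h :=
  xget 0 [set u | exists y z, [/\ nminus y, nplus z & x = y + gh e u + z]].

(* Extension of l by zero to the root spaces. *)
Definition ext0 (l : 'Hom(h, K^o)) (x : g) : K := l (cartan_part x).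

Definition weyl_vector (rho : 'Hom(h, K^o)) : Prop :=
  forall i, rho (coroot h i) = 2^-1 * alpha h i (coroot h i).

Definition pos_part : set g :=
  span_of [set x | exists2 k : int, 0 < k & principal k x].
Definition nonpos_part : set g :=
  span_of [set x | exists2 k : int, k <= 0 & principal k x].

Definition pi_plus (x : g) : g :=
  xget 0 [set y | pos_part y /\ nonpos_part (x - y)].
Definition pi_minus (x : g) : g := x - pi_plus x.

(* The class of the Kac-Peterson cocycle of the even part is trivial, being
   the coboundary of rho0. *)
Definition kac_peterson_trivialized_by (rho0 : 'Hom(h, K^o)) : Prop :=
  forall x y, homog g false x -> homog g false y ->
    let T1 v := [< x, pi_minus [< y, pi_plus v >] >] in
    let T2 v := [< y, pi_minus [< x, pi_plus v >] >] in
    exists t1 t2 : K,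
      [/\ has_trace (homog g false) T1 t1, has_trace (homog g false) T2 t2
        & ext0 rho0 [< x, y >] = 2^-1 * t1 - 2^-1 * t2].

Definition mod_weight (M : supermodule g) (l : 'Hom(h, K^o)) : set M :=
  [set v | forall u, act (gh e u) v = l u *: v].

Definition highest_weight (M : supermodule g) : Prop :=
  [/\ span_of (\bigcup_(l in setT) @mod_weight M l) = setT,
      (forall l, exists m (f : 'I_m -> M),
         @mod_weight M l `<=` span_of (range f))
    & exists (L : 'Hom(h, K^o)) (v : M),
      [/\ v <> 0, mod_weight L v, (forall x, nplus x -> act x v = 0)
        & forall S : set M, subspace S -> (forall x w, S w -> S (act x w)) ->
            S v -> S = setT]].

End KacMoody.

(* K[x_a : a in J] *)
Notation oscillator K J := {malg K[{cmonom J}]}.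

Section Oscillator.
Variables (K : fieldType) (J : choiceType).

Definition xmul (a : J) (P : oscillator K J) : oscillator K J :=
  << ucm a >> * P.

Definition xderiv (a : J) (P : oscillator K J) : oscillator K J :=
  \sum_(m <- msupp P) (P@_m *+ m a) *: << divcm m (ucm a) >>.

End Oscillator.

Section Dirac.
Variables (K : fieldType) (n : nat) (A : 'M[K]_n) (h : realization A).
Variables (g : lieSuperalg K) (e : generators h g) (B : g -> g -> K).
Variables (J : choiceType) (x_ d_ : J -> g).

(* x_ and d_ are bases of root vectors of the negative and of the positive
   odd part, dual up to the factor 1/2. *)
Definition oscillator_bases : Prop :=
  [/\ basis_family (homog g true `&` nminus e) x_,
      basis_family (homog g true `&` nplus e) d_,
      (forall a, (exists l, weight_vector e l (x_ a)) /\
                 (exists l, weight_vector e l (d_ a)))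
    & forall a b, B (d_ a) (x_ b) = if a == b then 2^-1 else 0].

(* Clifford action of odd y on K[x_a]: as B(d_a,x_b) = delta_ab/2, the
   coordinates of y are 2B(d_a,y) on x_a and 2B(y,x_a) on d_a, so the two sums
   are the actions of the components of y in n^- and in n^+. *)
Definition cl_minus (y : g) (P : oscillator K J) : oscillator K J :=
  \sum_(a \in [set: J]) (2 * B (d_ a) y) *: xmul a P.
Definition cl_plus (y : g) (P : oscillator K J) : oscillator K J :=
  \sum_(a \in [set: J]) (2 * B y (x_ a)) *: xderiv a P.
Definition cl (y : g) (P : oscillator K J) : oscillator K J :=
  cl_minus y P + cl_plus y P.

(* The normally ordered product :yz: of odd y and z. *)
Definition normal (y z : g) (P : oscillator K J) : oscillator K J :=
  cl_minus y (cl_minus z P) + cl_minus y (cl_plus z P)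
  + cl_minus z (cl_plus y P) + cl_plus y (cl_plus z P).

(* Action on K[x_a] of even x; rho1 is a linear form on h. *)
Definition osc_act (rho1 : 'Hom(h, K^o)) (x : g) (P : oscillator K J) :
    oscillator K J :=
  2^-1 *: \sum_(a \in [set: J]) normal [< x, x_ a >] (d_ a) P
  - 2^-1 *: \sum_(a \in [set: J]) normal [< x, d_ a >] (x_ a) P
  - ext0 e rho1 x *: P.

Variables (M : supermodule g) (T : tensor_product M (oscillator K J)).

Definition diag_act (rho1 : 'Hom(h, K^o)) (x : g) : T -> T :=
  tens_lift (fun v P => tens T (act x v) P + tens T v (osc_act rho1 x P)).

(* y (x) z for odd y and z, with the Koszul sign. *)
Definition tens_op (y z : g) : T -> T :=
  tens_lift (fun v P => tens T (act y (parity_sign v)) (cl z P)).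

Definition dirac (t : T) : T :=
  2 *: \sum_(a \in [set: J])
         (tens_op (x_ a) (d_ a) t - tens_op (d_ a) (x_ a) t).

End Dirac.

(* Main.v *)
(** The Dirac operator is a linear map that commutes with the diagonal action of
    every even x, so its kernel is stable.  For odd w one has
    [pi(x), w] = [x, w] on the oscillator module, whatever the constant
    rho_1(x) is; hence the commutator of the diagonal action of x with D is
    obtained by letting ad x act on sum_a (x_a (x) d_a - d_a (x) x_a), and it
    vanishes because B is invariant and the bases are dual.

    The sums involved are infinite, and the work lies in their finiteness.  By
    the principal grading, which is spanned in each degree by finitely many
    brackets of generators, only finitely many d_a have degree below a given
    bound.  Elements of high degree annihilate a given vector of the highest
    weight module, and ad x keeps those of high enough degree in n^+. *)
From HB Require Import structures.
From mathcomp Require Import zify.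
Require Import Defs.
Set Implicit Arguments.
Unset Strict Implicit.
Unset Printing Implicit Defensive.
Import Order.TTheory GRing.Theory Num.Theory.
Local Open Scope classical_set_scope.
Local Open Scope ring_scope.

(** * Linear algebra and finite sums *)

(** Normal ordering changes a product of two odd elements by a scalar, and over the basis infinitely
    many of these scalars may be nonzero. The commutator with a Clifford element is therefore taken
    summand by summand, where the scalar cancels, and only the resulting families, which have finite
    support, are summed. The basis vectors are tied to the principal grading by an element of h on
    which every simple root takes the value 1. Its adjoint action has eigenvalue k in degree k, so
    in characteristic 0 a root vector of n^+ is homogeneous, and by invariance B pairs degree j only
    with degree -j. Hence n^+ and n^- are isotropic, and pairing with the dual basis reads off
    coordinates. Matrix entries of ad x are thus values of B. Three sources of finiteness make the
    double sums exchangeable: almost all d_a kill a given polynomial, almost all kill a given vector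
    of M, and for almost all a the bracket [x, d_a] has no component in n^-. *)

Section Linear.
Variables (K : fieldType) (U V : lmodType K) (f : U -> V).
Hypothesis fL : linear f.

Lemma lin0 : f 0 = 0.
Proof. by have := fL (-1) 0 0; rewrite scaler0 addr0 scaleN1r addNr. Qed.

Lemma linD x y : f (x + y) = f x + f y.
Proof. by have := fL 1 x y; rewrite !scale1r. Qed.

Lemma linZ a x : f (a *: x) = a *: f x.
Proof. by have := fL a x 0; rewrite lin0 !addr0. Qed.

Lemma linN x : f (- x) = - f x.
Proof. by rewrite -scaleN1r linZ scaleN1r. Qed.

Lemma linB x y : f (x - y) = f x - f y.
Proof. by rewrite linD linN. Qed.

Lemma lin_sum (I : Type) (s : seq I) (h : I -> U) :
  f (\sum_(i <- s) h i) = \sum_(i <- s) f (h i).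
Proof. exact: (big_morph f linD lin0). Qed.

End Linear.

Section LinearOperations.
Variables (K : fieldType) (U V W : lmodType K).

Lemma linear_comp (f : V -> W) (f' : U -> V) :
  linear f -> linear f' -> linear (fun x => f (f' x)).
Proof. by move=> fL fL' k x y; rewrite fL' fL. Qed.

Lemma linear_add (f f' : U -> V) :
  linear f -> linear f' -> linear (fun x => f x + f' x).
Proof. by move=> fL fL' k x y; rewrite fL' fL scalerDr addrACA. Qed.

Lemma linear_scale (k : K) (f : U -> V) : linear f -> linear (fun x => k *: f x).
Proof. by move=> fL k' x y; rewrite fL scalerDr !scalerA mulrC. Qed.

Lemma linear_sub (f f' : U -> V) :
  linear f -> linear f' -> linear (fun x => f x - f' x).
Proof. by move=> fL fL' k x y; rewrite fL' fL scalerBr opprD addrACA. Qed.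
End LinearOperations.

Section Span.
Variables (K : fieldType) (V : lmodType K).
Implicit Types (S P : set V).

Lemma subspaceD S x y : subspace S -> S x -> S y -> S (x + y).
Proof. by move=> [_ H] Sx Sy; rewrite -[x]scale1r; exact: H. Qed.

Lemma subspaceZ S a x : subspace S -> S x -> S (a *: x).
Proof. by move=> [S0 H] Sx; rewrite -[_ *: _]addr0; exact: H. Qed.

Lemma subspaceN S x : subspace S -> S x -> S (- x).
Proof. by move=> HS Sx; rewrite -scaleN1r; exact: subspaceZ. Qed.

Lemma subspaceB S x y : subspace S -> S x -> S y -> S (x - y).
Proof. by move=> HS Sx Sy; apply: subspaceD => //; exact: subspaceN. Qed.

Lemma subspace_zero : subspace ([set 0] : set V).
Proof. by split=> [//|k u v -> ->]; rewrite /= scaler0 addr0. Qed.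

Lemma subspace_span S : subspace (span_of S).
Proof.
split=> [P [[P0 _] _] //|a u v Su Sv P PS]; have [[_ H] _] := PS.
by apply: H; [exact: Su|exact: Sv].
Qed.

Lemma sub_span S : S `<=` span_of S.
Proof. exact: sub_gen_smallest. Qed.

Lemma span_min S P : subspace P -> S `<=` P -> span_of S `<=` P.
Proof. exact: smallest_sub. Qed.

Lemma span_sub S P : S `<=` P -> span_of S `<=` span_of P.
Proof.
by move=> SP; apply: span_min; [exact: subspace_span|exact: subset_trans (@sub_span P)].
Qed.

Lemma preimage_subspace (W : lmodType K) (f : W -> V) S :
  linear f -> subspace S -> subspace (f @^-1` S).
Proof.
move=> fL [S0 SL]; split=> [|a u v Su Sv]; first by rewrite /preimage /= lin0.
by rewrite /preimage /= fL; exact: SL.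
Qed.

Lemma span_coef (s : seq V) (x : V) : span_of [set` s] x ->
  exists c : 'I_(size s) -> K, x = \sum_i c i *: s`_i.
Proof.
apply: (@span_min _ [set x | exists c, x = _]); first split.
- by exists (fun=> 0); rewrite big1 // => i _; rewrite scale0r.
- move=> a u v [c ->] [c' ->]; exists (fun i => a * c i + c' i).
  rewrite scaler_sumr -big_split /=; apply: eq_bigr => i _.
  by rewrite scalerDl scalerA.
- move=> y /= ys; have yi : (index y s < size s)%N by rewrite index_mem.
  exists (fun i => (i == Ordinal yi)%:R); rewrite (bigD1 (Ordinal yi)) //= eqxx.
  rewrite scale1r nth_index // big1 ?addr0 // => i /negbTE ->.
  by rewrite scale0r.
Qed.

(** More than [size s] vectors in the span of [s] have a coefficient matrix with more rows than
    columns; a nonzero vector of its left kernel is a linear relation between them. *)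
Lemma lin_indep_finite (J : choiceType) (e : J -> V) (s : seq V) :
  lin_indep e -> finite_set [set a | span_of [set` s] (e a)].
Proof.
move=> eI; apply: contrapT => /infinite_set_fset.
move=> /(_ (size s).+1) [F FS Fcard].
have [Fu mF] : uniq F /\ size F = #|` F| by rewrite fset_uniq.
have /choice [c Ec] a : exists c : 'I_(size s) -> K,
    a \in F -> e a = \sum_i c i *: s`_i.
  by case: (boolP (a \in F)) => [/FS/span_coef [c]|_]; [exists c|exists (fun=> 0)].
pose a_ (i : 'I_(size F)) : J := tnth (in_tuple F) i.
pose C := \matrix_(i < size F, j < size s) c (a_ i) j.
have : ~~ row_free C.
  by rewrite -row_leq_rank -ltnNge (leq_ltn_trans (rank_leq_col _)) // mF.
rewrite -kermx_eq0 => /rowV0Pn [u /sub_kermxP uC /rV0Pn [i ui]].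
(* [lin_indep] expects coefficients on all of [J], so [u] is extended by 0 outside [F]. *)
pose w a := if insub (index a F) is Some k then u 0 k else 0.
have wE k : w (a_ k) = u 0 k.
  have ik : index (a_ k) F = k by rewrite /a_ (tnth_nth (a_ k)) index_uniq.
  by rewrite /w ik valK.
have a_F k : a_ k \in (F : seq J) by rewrite /a_ mem_tnth.
move: ui; rewrite -wE (eI F w Fu) ?eqxx // big_tnth.
transitivity (\sum_k \sum_j (u 0 k * C k j) *: s`_j).
  apply: eq_bigr => k _; rewrite wE (Ec _ (a_F k)) scaler_sumr.
  by apply: eq_bigr => j _; rewrite scalerA mxE.
rewrite exchange_big big1 // => j _; rewrite -scaler_suml.
by move/rowP: uC => /(_ j); rewrite !mxE => ->; rewrite scale0r.
Qed.

End Span.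

Lemma span_lin (K : fieldType) (U V : lmodType K) (f : U -> V) (S : set U)
    (P : set V) : linear f -> subspace P -> (forall x, S x -> P (f x)) ->
  forall x, span_of S x -> P (f x).
Proof.
move=> fL PP SP x; apply: (span_min (P := f @^-1` P)) => //.
exact: preimage_subspace.
Qed.

Lemma span_bilin (K : fieldType) (U V W : lmodType K) (f : U -> V -> W)
    (S : set U) (S' : set V) (P : set W) : bilinear_map f -> subspace P ->
    (forall x y, S x -> S' y -> P (f x y)) ->
  forall x y, span_of S x -> span_of S' y -> P (f x y).
Proof.
move=> [fL fR] PS SP x y Sx Sy.
apply: (span_lin (fR y) PS _ Sx) => x' Sx'.
by apply: (span_lin (fL x') PS _ Sy) => y' Sy'; exact: SP.
Qed.

(** A sum [\sum_(a \in [set: J])] is 0 by convention when infinitely many terms are nonzero, so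
    additivity and linearity of such sums depend on this condition. *)
Definition fin_supp (J : choiceType) (W : zmodType) (f : J -> W) : Prop :=
  exists F : {fset J}, forall a, a \notin F -> f a = 0.

Section FiniteSupport.
Variables (K : fieldType) (J : choiceType).
Implicit Types (V W : lmodType K).

Lemma fin_supp_common W (f g : J -> W) : fin_supp f -> fin_supp g ->
  exists F : {fset J},
    (forall a, a \notin F -> f a = 0) /\ (forall a, a \notin F -> g a = 0).
Proof.
move=> [F Ff] [G Gg]; exists (F `|` G)%fset.
by split=> a; rewrite in_fsetU negb_or => /andP[aF aG]; [exact: Ff|exact: Gg].
Qed.

Lemma finite_fin_supp W (f : J -> W) (A : set J) :
  finite_set A -> (forall a, ~ A a -> f a = 0) -> fin_supp f.
Proof.
move=> /finite_fsetP [F AF] fA; exists F => a aF; apply: fA.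
by rewrite AF /=; exact/negP.
Qed.

Lemma fin_supp_sub V W (f : J -> V) (g : J -> W) :
  fin_supp f -> (forall a, f a = 0 -> g a = 0) -> fin_supp g.
Proof. by move=> [F Ff] fg; exists F => a /Ff /fg. Qed.

Lemma fin_suppD W (f g : J -> W) :
  fin_supp f -> fin_supp g -> fin_supp (fun a => f a + g a).
Proof.
move=> Hf /(fin_supp_common Hf) [F [Ff Fg]].
by exists F => a aF; rewrite Ff // Fg // addr0.
Qed.

Lemma fin_suppN W (f : J -> W) : fin_supp f -> fin_supp (fun a => - f a).
Proof. by move=> /fin_supp_sub; apply=> a ->; rewrite oppr0. Qed.

Lemma fin_suppB W (f g : J -> W) :
  fin_supp f -> fin_supp g -> fin_supp (fun a => f a - g a).
Proof. by move=> Hf Hg; apply: fin_suppD => //; exact: fin_suppN. Qed.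

Lemma fin_supp_lin V W (L : V -> W) (f : J -> V) :
  linear L -> fin_supp f -> fin_supp (fun a => L (f a)).
Proof. by move=> LL /fin_supp_sub; apply=> a ->; rewrite lin0. Qed.

Lemma fsum0 W (f : J -> W) : (forall a, f a = 0) -> \sum_(a \in [set: J]) f a = 0.
Proof. by move=> f0; rewrite fsbig1. Qed.

Lemma eq_fsum W (f g : J -> W) : f =1 g ->
  \sum_(a \in [set: J]) f a = \sum_(a \in [set: J]) g a.
Proof. by move=> fg; apply: eq_fsbigr => a _; exact: fg. Qed.

Lemma fsumD W (f g : J -> W) : fin_supp f -> fin_supp g ->
  \sum_(a \in [set: J]) (f a + g a) =
  \sum_(a \in [set: J]) f a + \sum_(a \in [set: J]) g a.
Proof.
move=> Hf /(fin_supp_common Hf) [F [Ff Fg]].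
rewrite !(fsbigTE F) ?big_split // => a aF.
by rewrite Ff // Fg // addr0.
Qed.

Lemma fsum_lin V W (L : V -> W) (f : J -> V) : linear L -> fin_supp f ->
  L (\sum_(a \in [set: J]) f a) = \sum_(a \in [set: J]) L (f a).
Proof.
move=> LL [F Ff]; rewrite !(fsbigTE F) ?lin_sum // => a aF.
by rewrite Ff // lin0.
Qed.

Lemma fsumZ W c (f : J -> W) : fin_supp f ->
  \sum_(a \in [set: J]) c *: f a = c *: \sum_(a \in [set: J]) f a.
Proof.
move=> Hf; rewrite (fsum_lin (L := fun x => c *: x)) //.
by move=> k u v; rewrite scalerDr !scalerA mulrC.
Qed.

Lemma fsumN W (f : J -> W) : fin_supp f ->
  \sum_(a \in [set: J]) - f a = - \sum_(a \in [set: J]) f a.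
Proof.
move=> Hf; rewrite -scaleN1r -fsumZ //.
by apply: eq_fsum => a; rewrite scaleN1r.
Qed.

Lemma fsumB W (f g : J -> W) : fin_supp f -> fin_supp g ->
  \sum_(a \in [set: J]) (f a - g a) =
  \sum_(a \in [set: J]) f a - \sum_(a \in [set: J]) g a.
Proof. by move=> Hf Hg; rewrite fsumD ?fsumN //; exact: fin_suppN. Qed.

Lemma fsum_delta W (f : J -> W) a :
  \sum_(b \in [set: J]) (a == b)%:R *: f b = f a.
Proof.
rewrite (fsbigTE [fset a]%fset) => [|b].
  by rewrite big_seq_fset1 eqxx scale1r.
by rewrite in_fset1 eq_sym => /negbTE ->; rewrite scale0r.
Qed.

Lemma linear_fsum V W (f : J -> V -> W) :
  (forall a, linear (f a)) -> (forall v, fin_supp (f^~ v)) ->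
  linear (fun v => \sum_(a \in [set: J]) f a v).
Proof.
move=> fL ff k u v; rewrite -fsumZ // -fsumD //; last first.
  by apply: fin_supp_sub (ff u) _ => a ->; rewrite scaler0.
by apply: eq_fsum => a; rewrite fL.
Qed.

(** Finitely many nonzero rows, each of finite support, confine the nonzero entries to a finite
    rectangle. *)
Lemma exchange_fsum W (f : J -> J -> W) (F : {fset J}) :
  (forall a b, a \notin F -> f a b = 0) -> (forall a, fin_supp (f a)) ->
  [/\ fin_supp (fun a => \sum_(b \in [set: J]) f a b),
      fin_supp (fun b => \sum_(a \in [set: J]) f a b)
    & \sum_(a \in [set: J]) \sum_(b \in [set: J]) f a b =
      \sum_(b \in [set: J]) \sum_(a \in [set: J]) f a b].
Proof.
move=> fF ff.
have [G Gf] : exists G : {fset J}, forall a b, b \notin G -> f a b = 0.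
  have /choice [h hP] := ff; exists (\bigcup_(a <- F) h a)%fset => a b.
  case: (boolP (a \in F)) => [aF|/fF //] bG; apply: hP; apply: contra bG.
  by apply/fsubsetP/bigfcup_sup.
have zF a : a \notin F -> \sum_(b \in [set: J]) f a b = 0.
  by move=> aF; apply: fsum0 => b; exact: fF.
have zG b : b \notin G -> \sum_(a \in [set: J]) f a b = 0.
  by move=> bG; apply: fsum0 => a; exact: Gf.
split; [by exists F|by exists G|].
rewrite (fsbigTE F) // (fsbigTE G) //.
under eq_bigr do rewrite (fsbigTE G) => [|b /Gf //].
under [RHS]eq_bigr do rewrite (fsbigTE F) => [|a /fF //].
exact: exchange_big.
Qed.

End FiniteSupport.

(** * Induction principles from universal properties *)

Section SubLmodule.
Variables (K : fieldType) (V : lmodType K) (S : set V) (SS : subspace S).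

Definition subspace_pred of subspace S : {pred V} := [pred x | `[< S x >]].
Local Notation P := (subspace_pred SS).

Fact subspace_pred_closed : submod_closed P.
Proof.
case: SS => S0 SL; split=> [|a u v]; first exact/asboolP.
by move=> /asboolP Su /asboolP Sv; apply/asboolP; exact: SL.
Qed.
HB.instance Definition _ := GRing.isSubmodClosed.Build K V P subspace_pred_closed.

Definition sub_lmod := {x : V | x \in P}.
HB.instance Definition _ := SubChoice.on sub_lmod.
HB.instance Definition _ := [SubChoice_isSubLmodule of sub_lmod by <:].

Definition sub_of (x : V) (Sx : S x) : sub_lmod := exist _ x (asboolT Sx).

Lemma sub_ofP (x : sub_lmod) : S (val x).
Proof. exact/asboolP/(valP x). Qed.
End SubLmodule.

Section TensorInduction.
Variables (K : fieldType) (U V : lmodType K) (T : tensor_product U V).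

Lemma tens_ext (W : lmodType K) (F G : T -> W) : linear F -> linear G ->
  (forall u v, F (tens T u v) = G (tens T u v)) -> F =1 G.
Proof.
move=> FL GL FG t.
have FB : bilinear_map (fun u v => F (tens T u v)).
  have [B1 B2] := tens_bilinear T.
  by split=> [u k x y|v k x y]; rewrite ?B1 ?B2 FL.
have [H [_ HU]] := tens_universal T FB.
rewrite -(HU F (conj FL (fun _ _ => erefl))).
by rewrite (HU G (conj GL (fun u v => esym (FG u v)))).
Qed.

(* The universal property factors the identity of T through S. *)
Lemma tens_ind (S : set T) : subspace S -> (forall u v, S (tens T u v)) ->
  forall t, S t.
Proof.
move=> SS ST.
have [B1 B2] := tens_bilinear T.
have fB : bilinear_map (fun u v => sub_of SS (ST u v)).
  by split=> [u k x y|v k x y]; apply: val_inj; rewrite /= ?B1 ?B2.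
have [F [[FL FE] _]] := tens_universal T fB.
have valF : (fun t => val (F t)) =1 id.
  apply: tens_ext => [k x y|//|u v]; last by rewrite FE.
  by rewrite FL.
by move=> t; rewrite -[t]valF; exact: sub_ofP.
Qed.

Lemma tens_liftP (W : lmodType K) (f : U -> V -> W) : bilinear_map f ->
  linear (tens_lift f : T -> W) /\ forall u v, tens_lift f (tens T u v) = f u v.
Proof.
move=> /(tens_universal T) [F [HF _]].
by rewrite /tens_lift; case: xgetP => [G _ //|/(_ F)/(_ HF)].
Qed.

Lemma tens_fin_supp (J : choiceType) (W : lmodType K) (f : J -> T -> W) :
  (forall a, linear (f a)) -> (forall u v, fin_supp (fun a => f a (tens T u v))) ->
  forall t, fin_supp (f^~ t).
Proof.
move=> fL fT; apply: tens_ind => //; split=> [|k x y fx fy].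
  by exists fset0 => a _; rewrite lin0.
have [F [Fx Fy]] := fin_supp_common fx fy.
by exists F => a aF; rewrite fL Fx // Fy // scaler0 addr0.
Qed.
End TensorInduction.

Section Superalgebra.
Variables (K : fieldType) (g : lieSuperalg K).

Lemma brkL (x : g) : linear (brk x).
Proof. by have [H _] := brk_bilinear g. Qed.
Lemma brkR (y : g) : linear (fun x : g => [< x, y >]).
Proof. by have [_ H] := brk_bilinear g. Qed.

Definition sub_superalg (S : set g) : Prop :=
  [/\ subspace S, (forall b x, S x -> S (part b x))
    & forall x y, S x -> S y -> S [< x, y >]].

Section SubSuperalg.
Variables (S : set g) (SS : sub_superalg S).

Let SV : subspace S. Proof. by case: SS. Qed.
Let Spart b x : S x -> S (part b x). Proof. by case: SS => _ H _; exact: H. Qed.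
Let Sbrk x y : S x -> S y -> S [< x, y >]. Proof. by case: SS => _ _; exact. Qed.
Let W := sub_lmod SV.
Let wpart b (x : W) : W := sub_of SV (Spart b (sub_ofP x)).
Let wbrk (x y : W) : W := sub_of SV (Sbrk (sub_ofP x) (sub_ofP y)).

Let wpartL b : linear (wpart b).
Proof. by move=> k x y; apply: val_inj; rewrite /= part_linear. Qed.
Let wpartpart b c x : wpart b (wpart c x) = if b == c then wpart c x else 0.
Proof. by apply: val_inj; rewrite /= part_part; case: eqP. Qed.
Let wpartsum x : wpart false x + wpart true x = x.
Proof. by apply: val_inj; rewrite /= part_sum. Qed.
Let Wsuper : superspace K := SuperSpace wpartL wpartpart wpartsum.

Let whomog b (x : Wsuper) : homog Wsuper b x -> homog g b (val x).
Proof. by move=> /(congr1 val). Qed.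
Let wbrk_bilinear : @bilinear_map K Wsuper Wsuper Wsuper wbrk.
Proof.
by split=> [u k x y|v k x y]; apply: val_inj; rewrite /= ?brkL ?brkR.
Qed.
Let wbrk_parity a b (x y : Wsuper) :
  homog _ a x -> homog _ b y -> homog Wsuper (a (+) b) (wbrk x y).
Proof.
move=> /whomog ax /whomog yb; apply: val_inj; exact: (brk_parity ax yb).
Qed.
Let wbrk_antisym a b (x y : Wsuper) : homog _ a x -> homog _ b y ->
  wbrk x y = - ((-1) ^+ (a && b) *: wbrk y x).
Proof.
move=> /whomog ax /whomog yb; apply: val_inj; exact: (brk_antisym ax yb).
Qed.
Let wbrk_jacobi a b (x y z : Wsuper) : homog _ a x -> homog _ b y ->
  wbrk x (wbrk y z) =
  wbrk (wbrk x y) z + (-1) ^+ (a && b) *: wbrk y (wbrk x z).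
Proof.
move=> /whomog ax /whomog yb; apply: val_inj; exact: (brk_jacobi _ ax yb).
Qed.

(** The universal property of a presentation speaks of Lie superalgebras, so a closed subset has to
    be made into one before the property can be applied to it. *)
Lemma sub_lieSuperalg : exists (g' : lieSuperalg K) (i : g' -> g),
  [/\ lie_morphism i, injective i & range i = S].
Proof.
exists (LieSuperalg wbrk_bilinear wbrk_parity wbrk_antisym wbrk_jacobi), val.
split; [by split | exact: val_inj |].
apply/seteqP; split=> [_ [x _ <-]|x Sx]; first exact: sub_ofP.
by exists (sub_of SV Sx).
Qed.
End SubSuperalg.
End Superalgebra.

Section Superspaces.
Variables (K : fieldType) (V : superspace K).

Lemma homog_part b (x : V) : homog V b (part b x).
Proof. by rewrite /homog /= part_part eqxx. Qed.

Lemma part_homog b c (x : V) : homog V c x -> part b x = if b == c then x else 0.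
Proof. by move=> xc; rewrite -xc part_part. Qed.

Lemma homog_ind (S : set V) : subspace S -> (forall b x, homog V b x -> S x) ->
  forall x, S x.
Proof.
move=> SS H x; rewrite -(part_sum x).
by apply: subspaceD => //; apply: H (homog_part _ _).
Qed.
End Superspaces.

Section Chevalley.
Variables (K : fieldType) (n : nat) (A : 'M[K]_n) (p : 'I_n -> bool).
Variable h : realization A.

Section Morphism.
Variables (g g' : lieSuperalg K) (f : g -> g').
Variables (e : generators h g) (e' : generators h g').
Hypotheses (fM : lie_morphism f) (fe : maps_generators e e' f).

Lemma chevalley_image : chevalley_relations p e -> chevalley_relations p e'.
Proof.
have [fL fp fb] := fM; have [fh fX fY] := fe.
have fhom b x : homog _ b x -> homog _ b (f x).
  by rewrite /homog /= -fp => ->.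
move=> [[eL e0] eXY ehh ehX eXYh]; split.
- by split=> [k u v|u]; rewrite -!fh ?eL ?fL //; exact: fhom.
- by move=> i; have [? ?] := eXY i; rewrite -fX -fY; split; exact: fhom.
- by move=> u v; rewrite -!fh -fb ehh lin0.
- move=> u i; have [hX hY] := ehX u i.
  by rewrite -fh -fX -fY -!fb hX hY !(linZ fL).
- by move=> i j; rewrite -fX -fY -fb eXYh; case: eqP; rewrite ?fh ?lin0.
Qed.

Lemma chevalley_preimage :
  injective f -> chevalley_relations p e' -> chevalley_relations p e.
Proof.
have [fL fp fb] := fM; have [fh fX fY] := fe.
move=> fI.
have fhom b x : homog _ b (f x) -> homog _ b x.
  by move=> bx; apply: fI; rewrite fp bx.
move=> [[eL e0] eXY ehh ehX eXYh]; split.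
- split=> [k u v|u]; first by apply: fI; rewrite fL !fh eL.
  by apply: fhom; rewrite fh.
- by move=> i; have [? ?] := eXY i; split; apply: fhom; rewrite ?fX ?fY.
- by move=> u v; apply: fI; rewrite fb !fh ehh lin0.
- move=> u i; have [hX hY] := ehX u i.
  by split; apply: fI; rewrite fb (linZ fL) fh ?fX ?fY ?hX ?hY.
- move=> i j; apply: fI; rewrite fb fX fY eXYh.
  by case: eqP; rewrite ?fh ?lin0.
Qed.
End Morphism.

Lemma contragredient_chevalley (g : lieSuperalg K) (e : generators h g) :
  contragredient p e -> chevalley_relations p e.
Proof.
by move=> [gt [et [q [[C _] [qM qe] _ _ _]]]]; exact: (chevalley_image qM qe C).
Qed.

(* The universal property factors the identity of g through S. *)
Lemma presented_ind (g : lieSuperalg K) (e : generators h g) (S : set g) :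
  presented p e -> sub_superalg S -> (forall u, S (gh e u)) ->
  (forall i, S (gX e i)) -> (forall i, S (gY e i)) -> forall x, S x.
Proof.
move=> [Ce eU] SS Sh SX SY.
have [g' [i [iM iI iS]]] := sub_lieSuperalg SS.
have pre y : S y -> exists x, i x = y by rewrite -iS => -[x _ <-]; exists x.
have /choice [h' h'E] := fun u => pre _ (Sh u).
have /choice [X' X'E] := fun j => pre _ (SX j).
have /choice [Y' Y'E] := fun j => pre _ (SY j).
pose e' := Generators h' X' Y'.
have ie : maps_generators e' e i by [].
have [f [[[fL fp fb] [fh fX fY]] _]] := eU _ _ (chevalley_preimage iM ie iI Ce).
have [F [_ FU]] := eU _ _ Ce.
have idF : id = F by apply/esym/FU.
have ifF : i \o f = F.
  have [iL ip ib] := iM; apply/esym/FU; split.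
    split=> [k x y|b x|x y] /=; by rewrite ?fL ?iL ?fp ?ip ?fb ?ib.
  by split=> [u|j|j] /=; rewrite ?fh ?fX ?fY.
move=> x; have -> : x = i (f x) by rewrite -[RHS]/((i \o f) x) ifF -idF.
by rewrite -iS; exists (f x).
Qed.

Lemma contragredient_ind (g : lieSuperalg K) (e : generators h g) (S : set g) :
  contragredient p e -> sub_superalg S -> (forall u, S (gh e u)) ->
  (forall i, S (gX e i)) -> (forall i, S (gY e i)) -> forall x, S x.
Proof.
move=> [gt [et [q [P [[qL qp qb] [qh qX qY]] qS _ _]]]] [SV Sp Sb] Sh SX SY y.
have [x <-] := qS y; move: x; apply: (presented_ind P) => [|u|i|i] /=.
- split=> [|b x|x z] /=; first exact: preimage_subspace.
  + by move=> /Sp; rewrite /preimage /= qp; exact.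
  + by rewrite /preimage /= qb; exact: Sb.
- by rewrite qh.
- by rewrite qX.
- by rewrite qY.
Qed.
End Chevalley.

(** * The principal grading *)

Section Brackets.
Variables (K : fieldType) (g : lieSuperalg K).
Implicit Types x y z : g.

Lemma brk0l y : [< 0, y >] = 0. Proof. exact: (lin0 (brkR y)). Qed.
Lemma brk0r x : [< x, 0 >] = 0. Proof. exact: (lin0 (brkL x)). Qed.
Lemma brkDl x x' y : [< x + x', y >] = [< x, y >] + [< x', y >].
Proof. exact: (linD (brkR y)). Qed.
Lemma brkDr x y y' : [< x, y + y' >] = [< x, y >] + [< x, y' >].
Proof. exact: (linD (brkL x)). Qed.
Lemma brkNr x y : [< x, - y >] = - [< x, y >].
Proof. exact: (linN (brkL x)). Qed.
Lemma brkZl k x y : [< k *: x, y >] = k *: [< x, y >].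
Proof. exact: (linZ (brkR y)). Qed.
Lemma brkZr k x y : [< x, k *: y >] = k *: [< x, y >].
Proof. exact: (linZ (brkL x)). Qed.

Lemma even_antisym x y : homog g false x -> [< x, y >] = - [< y, x >].
Proof.
move=> x0; move: y; apply: homog_ind => [|b y yb].
  split=> [|k u v]; first by rewrite brk0l brk0r oppr0.
  by rewrite /= brkDl brkDr brkZl brkZr => -> ->; rewrite scalerN opprD.
by rewrite (brk_antisym x0 yb) scale1r.
Qed.

Lemma even_jacobi x y z : homog g false x ->
  [< x, [< y, z >] >] = [< [< x, y >], z >] + [< y, [< x, z >] >].
Proof.
move=> x0; move: y; apply: homog_ind => [|b y yb].
  split=> [|k u v] /=.
    by rewrite !(brk0l, brk0r) addr0.
  rewrite !(brkDl, brkDr, brkZl, brkZr) => -> ->.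
  by rewrite scalerDr addrACA.
by rewrite (brk_jacobi z x0 yb) scale1r.
Qed.

Lemma brk_brk a b x y z : homog g a x -> homog g b y ->
  [< [< x, y >], z >] =
  [< x, [< y, z >] >] - (-1) ^+ (a && b) *: [< y, [< x, z >] >].
Proof. by move=> xa yb; rewrite (brk_jacobi z xa yb) addrK. Qed.

Lemma part_brk b x y : part b [< x, y >] =
  [< part false x, part b y >] + [< part true x, part (~~ b) y >].
Proof.
rewrite -{1}(part_sum x) -{1}(part_sum y).
rewrite brkDl !brkDr !(linD (part_linear b)).
have E c d : part b [< part c x, part d y >] =
    if b == c (+) d then [< part c x, part d y >] else 0.
  by apply: part_homog; apply: brk_parity; exact: homog_part.
rewrite (E false false) (E false true) (E true false) (E true true).
case: b {E} => /=.
  by rewrite add0r addr0.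
by rewrite addr0 add0r.
Qed.
End Brackets.

(** * Right-normed words in the generators *)

Section Words.
Variables (K : fieldType) (g : lieSuperalg K) (n : nat) (p : 'I_n -> bool).
Variables (H : set g) (z z' : 'I_n -> g).
Hypotheses (HS : subspace H) (H0 : forall u, H u -> homog g false u).
Hypotheses (zp : forall i, homog g (p i) (z i)).
Hypotheses (zp' : forall i, homog g (p i) (z' i)).
Hypotheses (Hz : forall u i, H u -> exists c, [< u, z i >] = c *: z i).
Hypotheses (zz : forall i j, H [< z' i, z j >]).

(** The families [z], [z'] stand for the X_i and the Y_i, or the other way round, and [H] for the
    image of the Cartan subalgebra, so one argument serves positive and negative degrees. Being a
    finite list, [words k] bounds the dimension of its degree. *)
Fixpoint words (k : nat) : seq g :=
  if k is k.+1 then [seq [< z i, w >] | i <- enum 'I_n, w <- words k]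
  else [seq z i | i <- enum 'I_n].
Local Notation W k := (span_of [set` words k]).

Lemma word_mem k x : x \in words k -> W k x. Proof. exact: sub_span. Qed.

Lemma word0 i : W 0 (z i).
Proof. by apply: word_mem; rewrite /= map_f ?mem_enum. Qed.

Lemma wordS k i w : W k w -> W k.+1 [< z i, w >].
Proof.
apply: span_lin => [||x /= xk]; [exact: brkL|exact: subspace_span|].
by apply: (word_mem (k := k.+1)); apply/allpairsP; exists (i, x); rewrite mem_enum.
Qed.

Lemma word0_ind (P : set g) :
  subspace P -> (forall i, P (z i)) -> W 0 `<=` P.
Proof. by move=> PS Pz; apply: span_min => // _ /= /mapP [i _ ->]. Qed.

Lemma wordS_ind k (P : set g) : subspace P ->
  (forall i x, W k x -> P [< z i, x >]) -> W k.+1 `<=` P.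
Proof.
move=> PS Pz; apply: span_min => // y.
rewrite -[_ y]/(is_true (y \in words k.+1)) => /allpairsP [[i x] [_ xk ->]].
by apply: Pz; exact: word_mem.
Qed.

Lemma word_cartan k u w : H u -> W k w -> W k [< u, w >].
Proof.
move=> Hu; have WS j := subspace_span [set` words j].
elim: k w => [|k IH].
  apply: (word0_ind (P := brk u @^-1` W 0)) => [|i].
    exact: preimage_subspace (brkL u) _.
  rewrite /preimage /=; have [c ->] := Hz i Hu.
  exact: (subspaceZ _ (WS 0%N) (word0 i)).
apply: (wordS_ind (P := brk u @^-1` W k.+1)) => [|i x xk].
  exact: preimage_subspace (brkL u) _.
rewrite /preimage /mkset even_jacobi; last exact: H0.
have [c ->] := Hz i Hu; rewrite brkZl.
apply: (subspaceD (WS _)); last by apply: wordS; exact: IH.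
by apply: (subspaceZ _ (WS _)); exact: wordS.
Qed.

Lemma word_cartanr k u w : H u -> W k w -> W k [< w, u >].
Proof.
move=> Hu Ww; rewrite -[brk w u]opprK -even_antisym; last exact: H0.
by apply: (subspaceN (subspace_span _)); exact: word_cartan.
Qed.

Lemma word_opp0 i w : W 0 w -> H [< z' i, w >].
Proof.
move: w; apply: (word0_ind (P := brk (z' i) @^-1` H)) => [|j]; last exact: zz.
exact: preimage_subspace (brkL _) _.
Qed.

(** By the Jacobi identity [z' i] passes the outermost letter [z j]; the correction [[z' i, z j]]
    lies in [H] and preserves words. For words of two letters the inner bracket is itself in [H], so
    the base case brackets a letter with [H] on the right. *)
Lemma word_oppS k i w : W k.+1 w -> W k [< z' i, w >].
Proof.
have WS j := subspace_span [set` words j].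
elim: k w => [|k IH]; apply: (wordS_ind (P := brk (z' i) @^-1` W _));
  do ?[exact: preimage_subspace (brkL _) _]; move=> j x xk;
  rewrite /preimage /mkset (brk_jacobi x (zp' i) (zp j));
  apply: (subspaceD (WS _)) (word_cartan (zz i j) xk) _;
  apply: (subspaceZ _ (WS _)).
  by apply: word_cartanr; [exact: word_opp0|exact: word0].
by apply: wordS; exact: IH.
Qed.
End Words.

Section Grading.
Variables (K : fieldType) (n : nat) (A : 'M[K]_n) (p : 'I_n -> bool).
Variables (h : realization A) (g : lieSuperalg K) (e : generators h g).
Hypothesis Ce : chevalley_relations p e.

Let ghL : linear (gh e). Proof. by case: Ce => -[]. Qed.
Let H := range (gh e).

Lemma homog_gh u : homog g false (gh e u).
Proof. by case: Ce => -[]. Qed.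

Let HS : subspace H.
Proof.
split; first by exists 0 => //; exact: (lin0 ghL).
by move=> k _ _ [u _ <-] [v _ <-]; exists (k *: u + v); rewrite ?ghL.
Qed.
Let H0 u : H u -> homog g false u. Proof. by move=> [v _ <-]; exact: homog_gh. Qed.
Let Xp i : homog g (p i) (gX e i). Proof. by case: Ce => _ /(_ i) []. Qed.
Let Yp i : homog g (p i) (gY e i). Proof. by case: Ce => _ /(_ i) []. Qed.
Let HX u i : H u -> exists c, [< u, gX e i >] = c *: gX e i.
Proof.
by move=> [v _ <-]; case: Ce => _ _ _ /(_ v i) [-> _] _; exists (alpha h i v).
Qed.
Let HY u i : H u -> exists c, [< u, gY e i >] = c *: gY e i.
Proof.
by move=> [v _ <-]; case: Ce => _ _ _ /(_ v i) [_ ->] _; exists (- alpha h i v).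
Qed.
Let XY i j : H [< gX e i, gY e j >].
Proof.
case: Ce => _ _ _ _ ->; case: eqP => _; first by exists (coroot h i).
by case: HS.
Qed.
Let YX i j : H [< gY e i, gX e j >].
Proof.
rewrite (brk_antisym (Yp i) (Xp j)); apply: (subspaceN HS).
by apply: (subspaceZ _ HS); exact: XY.
Qed.

(* The span of the right-normed brackets of |k| generators X_i (k > 0) or Y_i
   (k < 0); Negz k is - k.+1 and words z k has words of length k.+1. *)
Definition piece (k : int) : set g :=
  match k with
  | Posz 0 => H
  | Posz k.+1 => span_of [set` words (gX e) k]
  | Negz k => span_of [set` words (gY e) k]
  end.

Lemma subspace_piece k : subspace (piece k).
Proof. by case: k => [[|k]|k] //=; exact: subspace_span. Qed.

Lemma piece_gh k u y : piece k y -> piece k [< gh e u, y >].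
Proof.
have Hu : H (gh e u) by exists u.
case: k => [[|k]|k] /=.
- move=> [v _ <-]; case: Ce => _ _ -> _ _; by case: HS.
- exact: (word_cartan H0 HX).
- exact: (word_cartan H0 HY).
Qed.

Lemma piece_gX k i y : piece k y -> piece (1 + k) [< gX e i, y >].
Proof.
case: k => [[|k]|[|k]].
- move=> Hy; rewrite addr0.
  rewrite -[piece _]/(span_of [set` words (gX e) 0]).
  exact: (word_cartanr H0 HX Hy (word0 _)).
- move=> Wy; rewrite (_ : 1 + Posz k.+1 = Posz k.+2) //; exact: wordS.
- move=> Wy; rewrite (_ : 1 + Negz 0 = 0) //; exact: (word_opp0 HS XY).
- move=> Wy; rewrite (_ : 1 + Negz k.+1 = Negz k); last by lia.
  exact: (word_oppS HS H0 Yp Xp HY XY).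
Qed.

Lemma piece_gY k i y : piece k y -> piece (- 1 + k) [< gY e i, y >].
Proof.
case: k => [[|[|k]]|k].
- move=> Hy; rewrite addr0.
  rewrite -[piece _]/(span_of [set` words (gY e) 0]).
  exact: (word_cartanr H0 HY Hy (word0 _)).
- move=> Wy; rewrite addrC; exact: (word_opp0 HS YX).
- move=> Wy; rewrite (_ : - 1 + Posz k.+2 = Posz k.+1); last by lia.
  exact: (word_oppS HS H0 Xp Yp HX YX).
- move=> Wy; rewrite (_ : - 1 + Negz k = Negz k.+1); last by lia.
  exact: wordS.
Qed.

Lemma principal_part k x b : principal e k x -> principal e k (part b x).
Proof.
move=> kx; elim: kx b => {k x} [i|i|u|k|k a x y _ IHx _ IHy|j k x y _ IHx _ IHy] b.
- rewrite (part_homog b (Xp i)).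
  by case: eqP => _; [exact: principal_X|exact: principal_0].
- rewrite (part_homog b (Yp i)).
  by case: eqP => _; [exact: principal_Y|exact: principal_0].
- rewrite (part_homog b (homog_gh u)).
  by case: eqP => _; [exact: principal_h|exact: principal_0].
- rewrite (lin0 (part_linear b)); exact: principal_0.
- rewrite part_linear; exact: principal_lin.
- rewrite part_brk -[brk (part false x) _]scale1r.
  by apply: principal_lin; apply: principal_brk.
Qed.

(** This turns arbitrary bracketings into right-normed words: a bracket acts as the supercommutator
    of its factors, so only generators have to act on pieces. The induction runs over the even and
    odd parts of [x], since [brk_brk] requires homogeneous elements. *)
Lemma piece_brk m x k y : principal e m x -> piece k y ->
  piece (m + k) [< x, y >].
Proof.
move=> mx ky; suff Hb b : piece (m + k) [< part b x, y >].
  by rewrite -(part_sum x) brkDl; apply: (subspaceD (subspace_piece _)).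
have P0 l : piece l 0 by case: (subspace_piece l).
elim: mx b k y ky => {m x}
  [i|i|u|m|m a x x' _ IHx _ IHx'|m l x x' _ IHx _ IHx'] b k y ky.
- rewrite (part_homog b (Xp i)).
  by case: eqP => _; [exact: piece_gX|rewrite brk0l].
- rewrite (part_homog b (Yp i)).
  by case: eqP => _; [exact: piece_gY|rewrite brk0l].
- rewrite (part_homog b (homog_gh u)) add0r.
  by case: eqP => _; [exact: piece_gh|rewrite brk0l].
- by rewrite (lin0 (part_linear b)) brk0l.
- rewrite part_linear brkDl brkZl; have [_ L] := subspace_piece (m + k).
  by apply: L; [exact: IHx|exact: IHx'].
- have IH c d : piece (m + l + k) [< [< part c x, part d x' >], y >].
    rewrite (brk_brk _ (homog_part c x) (homog_part d x')).
    apply: (subspaceB (subspace_piece _)).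
      by rewrite -addrA; apply: IHx; exact: IHx'.
    apply: (subspaceZ _ (subspace_piece _)).
    by rewrite (addrC m) -addrA; apply: IHx'; exact: IHx.
  by rewrite part_brk brkDl; apply: (subspaceD (subspace_piece _)).
Qed.

Lemma principal_piece k x : principal e k x -> piece k x.
Proof.
elim=> {k x} [i|i|u|k|k a x y _ IHx _ IHy|j k x y jx _ _ ky].
- exact: word0.
- exact: word0.
- by exists u.
- by case: (subspace_piece k).
- by case: (subspace_piece k) => _; exact.
- exact: piece_brk.
Qed.

End Grading.

Lemma lie_subalg_generated (K : fieldType) (g : lieSuperalg K) (S : set g) :
  lie_subalg (smallest (@lie_subalg K g) S).
Proof.
split; first split=> [P [[[P0 _] _] _] //|a u v Pu Pv P HP].
  by have [[[_ PL] _] _] := HP; apply: PL; [exact: Pu|exact: Pv].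
by move=> x y Px Py P HP; have [[_ PB] _] := HP; apply: PB; [exact: Px|exact: Py].
Qed.

Section Triangular.
Variables (K : fieldType) (n : nat) (A : 'M[K]_n) (p : 'I_n -> bool).
Variables (h : realization A) (g : lieSuperalg K) (e : generators h g).
Hypothesis Ce : chevalley_relations p e.

Lemma principal_word k x : 0 < k -> principal e k x ->
  exists2 m : nat, k = Posz m.+1 & span_of [set` words (gX e) m] x.
Proof. by case: k => [[|m]|m] // _ /(principal_piece Ce) /=; exists m. Qed.

Lemma principal_nplus k x : 0 < k -> principal e k x -> nplus e x.
Proof.
move=> k0 /(principal_word k0) [m _]; move: x.
have [NS NB] := lie_subalg_generated (range (gX e)).
have NX i : nplus e (gX e i) by apply: sub_gen_smallest; exists i.
elim: m => [|m IH]; first exact: (word0_ind NS).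
by apply: (wordS_ind NS) => i x /IH Nx; exact: (NB _ _ (NX i) Nx).
Qed.

Lemma principal_nminus k x : k < 0 -> principal e k x -> nminus e x.
Proof.
case: k => [//|m] _ /(principal_piece Ce) /=; move: x.
have [NS NB] := lie_subalg_generated (range (gY e)).
have NY i : nminus e (gY e i) by apply: sub_gen_smallest; exists i.
elim: m => [|m IH]; first exact: (word0_ind NS).
by apply: (wordS_ind NS) => i x /IH Nx; exact: (NB _ _ (NY i) Nx).
Qed.

Lemma principal_span x : contragredient p e ->
  span_of [set x | exists k, principal e k x] x.
Proof.
move=> Ge; move: x; have PS := subspace_span [set x | exists k, principal e k x].
apply: (contragredient_ind Ge) => [|u|i|i].
- split=> // [b x Px|].
    apply: (span_lin (part_linear b) PS _ Px) => z [k kz]; apply: sub_span.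
    by exists k; exact: (principal_part Ce).
  apply: (span_bilin (brk_bilinear g)) => // x y [j jx] [k ky]; apply: sub_span.
  by exists (j + k); exact: principal_brk.
- by apply: sub_span; exists 0; exact: principal_h.
- by apply: sub_span; exists 1; exact: principal_X.
- by apply: sub_span; exists (-1); exact: principal_Y.
Qed.

Lemma pos_part_brk x y : pos_part e x -> pos_part e y -> pos_part e [< x, y >].
Proof.
have PS := subspace_span [set x | exists2 k : int, 0 < k & principal e k x].
move: x y; apply: (span_bilin (brk_bilinear g)) => // x y [j j0 jx] [k k0 ky].
by apply: sub_span; exists (j + k); [lia|exact: principal_brk].
Qed.

Lemma nplus_pos : nplus e `<=` pos_part e.
Proof.
apply: smallest_sub => [|_ [i _ <-]].
  by split; [exact: subspace_span|exact: pos_part_brk].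
by apply: sub_span; exists 1 => //; exact: principal_X.
Qed.

Definition neg_part : set g :=
  span_of [set x | exists2 k : int, k < 0 & principal e k x].

Lemma nminus_neg : nminus e `<=` neg_part.
Proof.
have PS := subspace_span [set x | exists2 k : int, k < 0 & principal e k x].
apply: smallest_sub => [|_ [i _ <-]].
  split; first exact: PS.
  apply: (span_bilin (brk_bilinear g)) => // x y [j j0 jx] [k k0 ky].
  by apply: sub_span; exists (j + k); [lia|exact: principal_brk].
by apply: sub_span; exists (-1) => //; exact: principal_Y.
Qed.

(* Independent linear forms map h onto K^n. *)
Lemma grading_element : exists u : h, forall i, alpha h i u = 1.
Proof.
pose b := vbasis {:h}; pose N := \matrix_(k < \dim {:h}, i < n) (alpha h i b`_k : K).
have [rN|] := boolP (row_full N).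
  have [r rE] : exists r : 'rV_(_), r *m N = const_mx 1.
    by have /submxP [r ->] := submx_full (const_mx 1 : 'rV_n) rN; exists r.
  exists (\sum_k r 0 k *: b`_k) => i.
  move/rowP: rE => /(_ i); rewrite !mxE linear_sum => <-.
  by apply: eq_bigr => k _; rewrite linearZ mxE.
rewrite /row_full -mxrank_tr -[_ == _]/(row_free N^T) -kermx_eq0.
move=> /rowV0Pn [c /sub_kermxP cN /rV0Pn [i0 /eqP []]].
have fr : free [tuple alpha h i | i < n] by move: (alpha_free h); rewrite -val_ord_tuple.
move/freeP: fr => /(_ (c 0)); apply.
apply/lfunP => v; rewrite zero_lfunE (coord_vbasis (memvf v)) linear_sum big1 // => k _.
rewrite linearZ /= sum_lfunE.
move/rowP: cN => /(_ k); rewrite !mxE => cN.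
suff -> : \sum_(i < n) (c 0 i *: [tuple alpha h i | i < n]`_i) b`_k = 0.
  by rewrite scaler0.
rewrite -[RHS]cN; apply: eq_bigr => i _.
by rewrite -tnth_nth tnth_mktuple scale_lfunE !mxE.
Qed.

Lemma principal_eigen u k x : (forall i, alpha h i u = 1) ->
  principal e k x -> [< gh e u, x >] = k%:~R *: x.
Proof.
move=> u1; have [_ _ Chh ChX _] := Ce.
elim=> {k x} [i|i|v|k|k a x y _ IHx _ IHy|j k x y _ IHx _ IHy].
- by have [-> _] := ChX u i; rewrite u1.
- by have [_ ->] := ChX u i; rewrite u1.
- by rewrite Chh scale0r.
- by rewrite brk0r scaler0.
- by rewrite brkDr brkZr IHx IHy scalerDr !scalerA mulrC.
- rewrite even_jacobi; last exact: (homog_gh Ce).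
  by rewrite IHx IHy brkZl brkZr -scalerDl intrD.
Qed.
End Triangular.

(** * Eigenvectors of the grading element *)

Section Eigen.
Variables (K : numFieldType) (n : nat) (A : 'M[K]_n) (p : 'I_n -> bool).
Variables (h : realization A) (g : lieSuperalg K) (e : generators h g).
Hypothesis Ce : chevalley_relations p e.

Let upto (N : nat) := span_of
  [set x | exists k : int, [/\ 0 < k, k <= N%:Z & principal e k x]].

Let US N : subspace (upto N) := subspace_span _.

Let uptoS N x : upto N.+1 x ->
  exists y z, [/\ upto N y, principal e N.+1%:Z z & x = y + z].
Proof.
move: x; apply: span_min.
  split=> [|k _ _ [y [z [Uy Pz ->]]] [y' [z' [Uy' Pz' ->]]]].
    exists 0, 0; split; [|exact: principal_0|by rewrite addr0].
    by case: (US N).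
  exists (k *: y + y'), (k *: z + z'); split.
  - by have [_ L] := US N; exact: L.
  - exact: principal_lin.
  - by rewrite scalerDr addrACA.
move=> x [k [k0 kN kx]]; have [kE|kN'] := eqVneq k N.+1%:Z.
  exists 0, x; split; [|by rewrite -kE|by rewrite add0r].
  by case: (US N).
exists x, 0; split; [|exact: principal_0|by rewrite addr0].
by apply: sub_span; exists k; split => //; lia.
Qed.

Let pos_upto x : pos_part e x -> exists N, upto N x.
Proof.
have mono N N' : (N <= N')%N -> upto N `<=` upto N'.
  move=> NN'; apply: span_sub => y [k [k0 kN ky]]; exists k; split => //; lia.
move: x; apply: span_min.
  split=> [|k u v [N Nu] [N' Nv]].
    exists 0%N; by case: (US 0).
  exists (N + N')%N; have [_ L] := US (N + N').
  by apply: L; [apply: mono Nu; exact: leq_addr|apply: mono Nv; exact: leq_addl].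
by move=> x [[k|//] k0 kx]; exists k; apply: sub_span; exists k%:Z.
Qed.

(* The grading element acts on the piece of degree k by k, so in characteristic
   0 an eigenvector lies in a single piece. *)
Lemma pos_eigen_homogeneous u c x : (forall i, alpha h i u = 1) ->
  pos_part e x -> [< gh e u, x >] = c *: x ->
  exists2 k : int, 0 < k & principal e k x.
Proof.
move=> u1 /pos_upto [N Nx] xc.
suff [->|[k [k0 _ kx]]] : x = 0 \/
    exists k : int, [/\ 0 < k, k <= N%:Z & principal e k x].
- by exists 1 => //; exact: principal_0.
- by exists k.
elim: N x c Nx xc => [|N IH] x c.
  move=> Nx _; left; move: x Nx; apply: (span_min (P := [set 0])).
    by split=> [//|k x y -> ->]; rewrite /= scaler0 addr0.
  by move=> x [k [k0 kN _]]; lia.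
move=> /uptoS [y [z [Ny Nz xE]]] xc.
have Tz := principal_eigen Ce u1 Nz.
have NTy : upto N [< gh e u, y >].
  apply: (span_lin (brkL (gh e u)) (US N) _ Ny) => w [k [k0 kN kw]].
  rewrite (principal_eigen Ce u1 kw); apply: (subspaceZ _ (US N)).
  by apply: sub_span; exists k.
(* If [c] is the top degree, the lower part [y] is an eigenvector for the value [N.+1]; but by
   induction it is zero or homogeneous of degree at most [N], so it vanishes. *)
have [cE|cN] := eqVneq c N.+1%:~R.
  have yc : [< gh e u, y >] = N.+1%:~R *: y.
    have : y = x - z by rewrite xE addrK.
    by move=> ->; rewrite brkDr brkNr xc Tz cE scalerBr.
  have [y0|[k [k0 kN ky]]] := IH y _ Ny yc.
    right; exists N.+1%:Z; split => //; by rewrite xE y0 add0r.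
  right; exists N.+1%:Z; split => //.
  suff -> : x = z by [].
  rewrite xE; suff -> : y = 0 by rewrite add0r.
  have /eqP := principal_eigen Ce u1 ky.
  rewrite yc -subr_eq0 -scalerBl scaler_eq0 subr_eq0 eqr_int => /orP [/eqP|/eqP //].
  by lia.
(* Otherwise [ad u - N.+1] kills the top component and multiplies [x] by the nonzero scalar
   [c - N.+1], so [x] already lies in the lower degrees. *)
have Nx : upto N x.
  have -> : x = (c - N.+1%:~R)^-1 *: ([< gh e u, y >] - N.+1%:~R *: y).
    apply: (scalerI (a := c - N.+1%:~R)); first by rewrite subr_eq0.
    rewrite scalerA divff ?subr_eq0 // scale1r scalerBl -xc xE brkDr Tz.
    by rewrite scalerDr opprD addrACA subrr addr0.
  apply: (subspaceZ _ (US N)); apply: (subspaceB (US N)) => //.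
  exact: (subspaceZ _ (US N)).
have [->|[k [k0 kN kx]]] := IH x c Nx xc; first by left.
by right; exists k; split => //; lia.
Qed.
End Eigen.

(** * The standard form and the dual bases *)

Section Form.
Variables (K : numFieldType) (n : nat) (A : 'M[K]_n) (p : 'I_n -> bool).
Variables (h : realization A) (g : lieSuperalg K) (e : generators h g).
Variables (d : 'rV[K]_n) (B : g -> g -> K).
Hypotheses (Ge : contragredient p e) (Bf : standard_form e d B).

Let Ce := contragredient_chevalley Ge.
Let BL x : linear (B x : g -> K^o). Proof. by case: Bf => -[]. Qed.
Let BR y : linear (B^~ y : g -> K^o). Proof. by case: Bf => -[]. Qed.

Lemma form0l y : B 0 y = 0. Proof. exact: (lin0 (BR y)). Qed.
Lemma form0r x : B x 0 = 0. Proof. exact: (lin0 (BL x)). Qed.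
Lemma formDl x x' y : B (x + x') y = B x y + B x' y.
Proof. exact: (linD (BR y)). Qed.
Lemma formDr x y y' : B x (y + y') = B x y + B x y'.
Proof. exact: (linD (BL x)). Qed.
Lemma formNl x y : B (- x) y = - B x y. Proof. exact: (linN (BR y)). Qed.
Lemma formZl k x y : B (k *: x) y = k * B x y. Proof. exact: (linZ (BR y)). Qed.
Lemma formZr k x y : B x (k *: y) = k * B x y. Proof. exact: (linZ (BL x)). Qed.

Lemma form_even_odd x y : homog g false x -> homog g true y ->
  B x y = 0 /\ B y x = 0.
Proof. by case: Bf => _ [H _] _ _ _; exact: H. Qed.

Lemma form_odd_odd x y : homog g true x -> homog g true y -> B x y = - B y x.
Proof.
by case: Bf => _ [_ H] _ _ _ x1 y1; rewrite (H _ _ _ _ x1 y1) expr1 mulN1r.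
Qed.

Lemma form_even_inv x y z : homog g false x -> B [< x, y >] z = - B y [< x, z >].
Proof.
by case: Bf => _ _ inv _ _ x0; rewrite (even_antisym y x0) formNl inv.
Qed.

(** Invariance under the grading element gives [(j + k) * B x y = 0], and an integer that is nonzero
    stays nonzero in characteristic 0. *)
Lemma form_principal j k x y : principal e j x -> principal e k y ->
  j + k != 0 -> B x y = 0.
Proof.
move=> jx ky jk0; have [u u1] := grading_element h.
have := form_even_inv x y (homog_gh Ce u).
rewrite (principal_eigen Ce u1 jx) (principal_eigen Ce u1 ky) formZl formZr.
move/eqP; rewrite -subr_eq0 opprK -mulrDl -intrD mulf_eq0 intr_eq0.
by rewrite (negbTE jk0) => /eqP.
Qed.

Let form_span (S S' : set g) : (forall x y, S x -> S' y -> B x y = 0) ->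
  forall x y, span_of S x -> span_of S' y -> B x y = 0.
Proof.
move=> SS'; apply: (span_bilin (f := B : g -> g -> K^o) (P := [set 0])) => //.
by split=> [//|k u v -> ->]; rewrite /= scaler0 addr0.
Qed.

Lemma form_pos x y : pos_part e x -> pos_part e y -> B x y = 0.
Proof.
apply: form_span => {}x {}y [j j0 jx] [k k0 ky].
by apply: form_principal jx ky _; lia.
Qed.

Lemma form_neg x y : neg_part e x -> neg_part e y -> B x y = 0.
Proof.
apply: form_span => {}x {}y [j j0 jx] [k k0 ky].
by apply: form_principal jx ky _; lia.
Qed.

Section Bases.
Variables (J : choiceType) (x_ d_ : J -> g).
Hypothesis xd : oscillator_bases e B x_ d_.

Lemma osc_neg a : homog g true (x_ a) /\ nminus e (x_ a).
Proof.
case: xd => -[_ xS] _ _ _.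
suff : (homog g true `&` nminus e) (x_ a) by [].
by rewrite -xS; apply: sub_span; exists a.
Qed.

Lemma osc_pos a : homog g true (d_ a) /\ nplus e (d_ a).
Proof.
case: xd => _ [_ dS] _ _.
suff : (homog g true `&` nplus e) (d_ a) by [].
by rewrite -dS; apply: sub_span; exists a.
Qed.

Let x1 a : homog g true (x_ a). Proof. by case: (osc_neg a). Qed.
Let d1 a : homog g true (d_ a). Proof. by case: (osc_pos a). Qed.

Lemma form_dx a b : 2 * B (d_ a) (x_ b) = (a == b)%:R.
Proof.
case: xd => _ _ _ ->; case: eqP => _; last by rewrite mulr0.
by rewrite divff // pnatr_eq0.
Qed.

Lemma form_dd a b : B (d_ a) (d_ b) = 0.
Proof.
have [_ /nplus_pos da] := osc_pos a; have [_ /nplus_pos db] := osc_pos b.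
exact: form_pos.
Qed.

Lemma form_xx a b : B (x_ a) (x_ b) = 0.
Proof.
have [_ /nminus_neg xa] := osc_neg a; have [_ /nminus_neg xb] := osc_neg b.
exact: form_neg.
Qed.

Lemma form_xd a b : 2 * B (x_ a) (d_ b) = - (b == a)%:R.
Proof. by rewrite form_odd_odd // mulrN form_dx. Qed.

Lemma osc_pos_principal a : exists2 k : int, 0 < k & principal e k (d_ a).
Proof.
have [u u1] := grading_element h; case: xd => _ _ /(_ a) [_ [l dl]] _.
apply: (pos_eigen_homogeneous Ce u1 _ (dl u)).
by have [_ /nplus_pos] := osc_pos a.
Qed.

(** The exceptional [d_ a] lie in the span of the words of at most [|N|] letters, a finite list, and
    they are linearly independent. *)
Lemma finite_low_degree (N : int) :
  finite_set [set a | ~ exists2 k : int, N <= k & principal e k (d_ a)].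
Proof.
pose s := flatten [seq words (gX e) k | k <- iota 0 `|N|%N].
have [_ [dI _] _ _] := xd.
apply: sub_finite_set (lin_indep_finite s dI) => a /= low.
have [k k0 ka] := osc_pos_principal a.
have [m kE ma] := principal_word Ce k0 ka.
have kN : k < N by rewrite ltNge; apply/negP => Nk; apply: low; exists k.
apply: span_sub ma => w /= wm; apply/flatten_mapP; exists m => //.
by rewrite mem_iota /=; lia.
Qed.

(** Degree 0 is the image of the Cartan subalgebra, which is even; the odd part of a homogeneous
    element therefore lies in n^- or in n^+. *)
Lemma odd_span y : homog g true y -> span_of (range x_ `|` range d_) y.
Proof.
have [[_ xS] [_ dS] _ _] := xd.
have SS := subspace_span (range x_ `|` range d_).
move=> <-; apply: (span_lin (part_linear true) SS _ (principal_span Ce y Ge)).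
move=> z [k kz]; have kz' := principal_part Ce true kz.
have z1 := homog_part true z.
have [k0|k0|kE] := ltgtP k 0.
- suff : span_of (range x_) (part true z) by apply: span_sub => t; left.
  by rewrite xS; split => //; exact: (principal_nminus Ce k0).
- suff : span_of (range d_) (part true z) by apply: span_sub => t; right.
  by rewrite dS; split => //; exact: (principal_nplus Ce k0).
- move: kz; rewrite kE => /(principal_piece Ce) [u _ <-].
  by rewrite (part_homog true (homog_gh Ce u)); case: SS.
Qed.

Lemma odd_ind (P : set g) : subspace P ->
  (forall a, P (x_ a)) -> (forall a, P (d_ a)) ->
  forall y, homog g true y -> P y.
Proof.
move=> PS Px Pd y /odd_span; apply: span_min PS _ _.
by move=> _ [[a _ <-]|[a _ <-]].
Qed.

Lemma fin_supp_coord y : fin_supp (fun a => 2 * B (d_ a) y) /\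
  fin_supp (fun a => 2 * B y (x_ a)).
Proof.
pose P := [set y | fin_supp (fun a => 2 * B (d_ a) y) /\
  fin_supp (fun a => 2 * B y (x_ a))].
have PS : subspace P.
  split=> [|k u v [Fu Gu] [Fv Gv]].
    by split; exists fset0 => a _; rewrite ?form0l ?form0r mulr0.
  split.
    have [F [H1 H2]] := fin_supp_common (K := K) (W := K^o) Fu Fv.
    exists F => a aF; rewrite formDr formZr mulrDr mulrCA.
    by rewrite H1 // H2 // mulr0 addr0.
  have [F [H1 H2]] := fin_supp_common (K := K) (W := K^o) Gu Gv.
  exists F => a aF; rewrite formDl formZl mulrDr mulrCA.
  by rewrite H1 // H2 // mulr0 addr0.
move: y; apply: (homog_ind (S := P) PS) => -[] y yb.
  move: y yb; apply: (odd_ind PS) => b; split; exists [fset b]%fset => a;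
    rewrite in_fset1 => ab.
  - by rewrite form_dx (negbTE ab).
  - by rewrite form_xx mulr0.
  - by rewrite form_dd mulr0.
  - by rewrite form_dx eq_sym (negbTE ab).
split; exists fset0 => a _.
  by have [_ ->] := form_even_odd yb (d1 a); rewrite mulr0.
by have [-> _] := form_even_odd yb (x1 a); rewrite mulr0.
Qed.

(** The expansion of [y] in the dual bases is passed through [f] at once because it is applied under
    [ad x], under the action on [M] and under the Clifford action. By linearity it only has to be
    checked on [x_ b] and [d_ b]. *)
Lemma odd_expansion (W : lmodType K) (f : g -> W) y :
  linear f -> homog g true y ->
  f y = \sum_(a \in [set: J]) (2 * B (d_ a) y) *: f (x_ a)
      + \sum_(a \in [set: J]) (2 * B y (x_ a)) *: f (d_ a).
Proof.
move=> fL y1.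
have fsZ (c : J -> K) (w : J -> W) : fin_supp c -> fin_supp (fun a => c a *: w a).
  by move=> [F Fc]; exists F => a /Fc ->; rewrite scale0r.
move: y y1; apply: (odd_ind (P := [set y | f y = _])) => [|b|b] /=.
- split=> [|k u v /= Eu Ev] /=.
    by rewrite (lin0 fL) !fsum0 ?addr0 // => a; rewrite ?form0l ?form0r mulr0 scale0r.
  have [Fu Gu] := fin_supp_coord u; have [Fv Gv] := fin_supp_coord v.
  rewrite fL Eu Ev scalerDr addrACA; congr (_ + _).
    rewrite -fsumZ -?fsumD; do ?[exact: fsZ]; last first.
      by apply: fin_supp_sub (fsZ _ (fun a => f (x_ a)) Fu) _ => a ->; rewrite scaler0.
    by apply: eq_fsum => a; rewrite formDr formZr mulrDr scalerDl scalerA mulrCA.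
  rewrite -fsumZ -?fsumD; do ?[exact: fsZ]; last first.
    by apply: fin_supp_sub (fsZ _ (fun a => f (d_ a)) Gu) _ => a ->; rewrite scaler0.
  by apply: eq_fsum => a; rewrite formDl formZl mulrDr scalerDl scalerA mulrCA.
- rewrite [X in _ + X]fsum0 => [|a]; last by rewrite form_xx mulr0 scale0r.
  rewrite addr0 -(fsum_delta (fun a => f (x_ a)) b).
  by apply: eq_fsum => a; rewrite form_dx eq_sym.
- rewrite [X in X + _]fsum0 => [|a]; last by rewrite form_dd mulr0 scale0r.
  rewrite add0r -(fsum_delta (fun a => f (d_ a)) b).
  by apply: eq_fsum => a; rewrite form_dx.
Qed.

End Bases.
End Form.

(** * The oscillator module *)

Section Polynomials.
Variables (K : fieldType) (J : choiceType).
Implicit Types (P : oscillator K J) (a b : J) (m : {cmonom J}).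
Local Notation mon m := (<< m >> : oscillator K J).

Lemma xmul_linear a : linear (@xmul K J a).
Proof. by move=> k P Q; rewrite /xmul mulrDr -scalerAr. Qed.

Lemma malgZU (c : K) m : c *: mon m = << c *g m >>.
Proof.
apply/malgP => k; rewrite mcoeffZ [in RHS](@mcoeffU _ K) mcoeffU1.
by case: (m == k); rewrite ?mulr1n ?mulr0n ?mulr1 ?mulr0.
Qed.

Lemma mon_ind (S : set (oscillator K J)) :
  subspace S -> (forall m, S (mon m)) -> forall P, S P.
Proof.
move=> SS Sm P; rewrite (monalgE P).
elim: (enum_fset (msupp P)) => [|m s IH].
  by rewrite big_nil; case: SS.
rewrite big_cons; apply: subspaceD => //.
rewrite -malgZU; exact: subspaceZ.
Qed.

Lemma cmonomP m m' : (forall i, m i = m' i) -> m = m'.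
Proof. by move=> mm; apply/eqP/cmP. Qed.

(** [xderiv] sums over the support of [P], which is not additive in [P]; this formula for the
    coefficients makes linearity visible. *)
Lemma mcoeff_xderiv a P m : (xderiv a P)@_m = P@_(mulcm (ucm a) m) *+ (m a).+1.
Proof.
have E m' : ((P@_m' *+ m' a) *: mon (divcm m' (ucm a)))@_m =
    if m' == mulcm (ucm a) m then P@_m' *+ (m a).+1 else 0.
  rewrite mcoeffZ mcoeffU1; case: (eqVneq m') => [->|mm'].
    rewrite [divcm _ _](_ : _ = m) ?eqxx ?mulr1; last first.
      by apply: cmonomP => i; rewrite divcmE mulcmE addKn.
    by rewrite mulcmE ucmE eqxx add1n.
  (* Truncated division can yield [m] from a monomial not divisible by the variable [a], but then
     the exponent [m' a] is 0 and so is the term. *)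
  case: eqP => [mE|_]; last by rewrite mulr0.
  suff -> : m' a = 0%N by rewrite mulr0n mul0r.
  apply/eqP; apply: contraNT mm' => m'a; apply/eqP/cmonomP => i.
  rewrite mulcmE -mE divcmE subnKC // ucmE.
  by case: eqP => [ <-|//]; rewrite lt0n.
rewrite /xderiv raddf_sum (eq_bigr _ (fun m' _ => E m')) /=.
case: (boolP (mulcm (ucm a) m \in msupp P)) => mP.
  rewrite (big_fsetD1 _ mP) /= eqxx big1_fset ?addr0 // => m'.
  by rewrite in_fsetD1 => /andP[/negbTE -> _].
rewrite (mcoeff_outdom mP) mul0rn big1_fset // => m' m'P _.
by case: eqP mP => // <-; rewrite m'P.
Qed.

Lemma xderiv_linear a : linear (@xderiv K J a).
Proof.
move=> k P Q; apply/malgP => m.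
have CD (P' Q' : oscillator K J) m' : (P' + Q')@_m' = P'@_m' + Q'@_m'.
  exact: mcoeffD.
have CZ (c : K) (P' : oscillator K J) m' : (c *: P')@_m' = c * P'@_m'.
  exact: mcoeffZ.
rewrite [LHS]mcoeff_xderiv [in LHS]CD [in LHS]CZ [RHS]CD [in RHS]CZ.
have E (x y : K) i : (k * x + y) *+ i = k * (x *+ i) + y *+ i.
  by rewrite mulrnDl mulrnAr.
by rewrite E -(mcoeff_xderiv a P) -(mcoeff_xderiv a Q).
Qed.

Lemma xderiv_mon a m : xderiv a (mon m) = (m a)%:R *: mon (divcm m (ucm a)).
Proof.
by rewrite /xderiv msuppU1 big_seq_fset1 mcoeffU1 eqxx.
Qed.

Lemma xmul_mon a m : xmul a (mon m) = mon (mulcm (ucm a) m).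
Proof. by rewrite /xmul malgM_def fgmulUU mulr1. Qed.

Lemma fin_supp_xderiv P : fin_supp (fun a => xderiv a P).
Proof.
move: P; apply: (mon_ind (S := [set P | fin_supp (fun a => xderiv a P)])).
  split=> [|k P Q HP HQ].
    by exists fset0 => a _; rewrite (lin0 (@xderiv_linear a)).
  have [F [FP FQ]] := fin_supp_common HP HQ.
  by exists F => a aF; rewrite xderiv_linear FP // FQ // scaler0 addr0.
move=> m; exists (finsupp m) => a am.
by rewrite xderiv_mon (fsfun_dflt am) scale0r.
Qed.

Let mon_eq (f f' : oscillator K J -> oscillator K J) :
  linear f -> linear f' ->
  (forall m, f (mon m) = f' (mon m)) -> forall P, f P = f' P.
Proof.
move=> fL fL' ff'; apply: (mon_ind (S := [set P | f P = f' P])) => //.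
by split=> [|k P Q /= EP EQ] /=; rewrite ?(lin0 fL) ?(lin0 fL') ?fL ?fL' ?EP ?EQ.
Qed.

Lemma xmulC a b P : xmul a (xmul b P) = xmul b (xmul a P).
Proof.
apply: (mon_eq (f := xmul a \o xmul b) (f' := xmul b \o xmul a))
  => [k Q Q'|k Q Q'|m] /=; do ?by rewrite !xmul_linear.
have E c c' : xmul c (xmul c' (mon m)) = mon (mulcm (ucm c) (mulcm (ucm c') m)).
  by rewrite (xmul_mon c' m); exact: xmul_mon.
apply: (etrans (E a b)); apply: (etrans _ (esym (E b a))).
apply: (congr1 (fun k => mon k)); apply: cmonomP => i.
by rewrite !mulcmE addnCA.
Qed.

Lemma xderivC a b P : xderiv a (xderiv b P) = xderiv b (xderiv a P).
Proof.
have [->//|ab] := eqVneq a b.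
apply: (mon_eq (f := xderiv a \o xderiv b) (f' := xderiv b \o xderiv a))
  => [k Q Q'|k Q Q'|m] /=; do ?by rewrite !xderiv_linear.
have E c c' : xderiv c (xderiv c' (mon m)) =
    ((m c')%:R * (divcm m (ucm c') c)%:R) *: mon (divcm (divcm m (ucm c')) (ucm c)).
  rewrite (xderiv_mon c' m) (linZ (@xderiv_linear c)) -scalerA.
  exact: (congr1 (fun Q => _ *: Q) (xderiv_mon _ _)).
apply: (etrans (E a b)); apply: (etrans _ (esym (E b a))).
apply: (congr2 (fun c k => c *: mon k)).
  by rewrite !divcmE !ucmE eq_sym (negbTE ab) !subn0 mulrC.
by apply: cmonomP => i; rewrite !divcmE subnAC.
Qed.

Lemma xderiv_xmul a b P :
  xderiv a (xmul b P) = xmul b (xderiv a P) + (a == b)%:R *: P.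
Proof.
apply: (mon_eq (f := xderiv a \o xmul b)
    (f' := fun P => xmul b (xderiv a P) + (a == b)%:R *: P)) => [k Q Q'|k Q Q'|m] /=.
- by rewrite xmul_linear xderiv_linear.
- rewrite xderiv_linear xmul_linear !scalerDr !scalerA addrACA.
  by rewrite [_ * k]mulrC.
rewrite (xmul_mon b m) (_ : xmul b _ =
    (m a)%:R *: mon (mulcm (ucm b) (divcm m (ucm a)))); last first.
  rewrite (xderiv_mon a m) (linZ (@xmul_linear b)).
  exact: (congr1 (fun Q => _ *: Q) (xmul_mon _ _)).
apply: (etrans (xderiv_mon _ _)); rewrite mulcmE ucmE.
have [->|ab] := eqVneq a b.
  have -> : divcm (mulcm (ucm b) m) (ucm b) = m.
    by apply: cmonomP => i; rewrite divcmE mulcmE addKn.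
  have SD (V : lmodType K) k (v : V) :
      (true + k)%:R *: v = k%:R *: v + true%:R *: v.
    by rewrite natrD scalerDl addrC.
  apply: (etrans (SD _ _ _)); apply: (congr2 +%R _ erefl).
  (* If [m b = 0], multiplying back after the truncated division does not restore [m], but the
     coefficient is 0. *)
  have [->|mb] := eqVneq (m b) 0%N.
    exact: (etrans (scale0r _) (esym (scale0r _))).
  apply: (congr1 (fun k => _ *: mon k)); apply: cmonomP => i.
  rewrite mulcmE divcmE ucmE.
  by case: eqP => [ <-|_]; rewrite ?subnKC ?lt0n.
rewrite add0n scale0r addr0; apply: (congr1 (fun k => _ *: mon k)); apply: cmonomP => i.
rewrite !(mulcmE, divcmE, ucmE).
have : ~~ ((b == i) && (a == i)) by apply: contra ab => /andP[/eqP -> /eqP ->].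
by case: (b == i); case: (a == i) => //= _; lia.
Qed.
End Polynomials.

(** * The Clifford action and its commutator with the even part *)

Section Clifford.
Variables (K : numFieldType) (n : nat) (A : 'M[K]_n) (p : 'I_n -> bool).
Variables (h : realization A) (g : lieSuperalg K) (e : generators h g).
Variables (d : 'rV[K]_n) (B : g -> g -> K).
Variables (J : choiceType) (x_ d_ : J -> g).
Hypotheses (Ge : contragredient p e) (Bf : standard_form e d B).
Hypothesis xd : oscillator_bases e B x_ d_.

(* Of the oscillator module only the Weyl relations are used: xm a and xdv a stand
   for x_a and d/dx_a, cm y and cp y for the actions of the components of y in
   n^- and n^+. *)
Variables (O : lmodType K) (xm xdv : J -> O -> O) (cm cp : g -> O -> O).
Hypotheses (xmL : forall a, linear (xm a)) (xdvL : forall a, linear (xdv a)).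
Hypothesis xmC : forall a b P, xm a (xm b P) = xm b (xm a P).
Hypothesis xdvC : forall a b P, xdv a (xdv b P) = xdv b (xdv a P).
Hypothesis xdv_xm : forall a b P,
  xdv a (xm b P) = xm b (xdv a P) + (a == b)%:R *: P.
Hypothesis fin_xdv : forall P, fin_supp (fun a => xdv a P).
Hypothesis cmE : forall y P,
  cm y P = \sum_(a \in [set: J]) (2 * B (d_ a) y) *: xm a P.
Hypothesis cpE : forall y P,
  cp y P = \sum_(a \in [set: J]) (2 * B y (x_ a)) *: xdv a P.

Let Ce := contragredient_chevalley Ge.
Let x1 a : homog g true (x_ a). Proof. by case: (osc_neg xd a). Qed.
Let d1 a : homog g true (d_ a). Proof. by case: (osc_pos xd a). Qed.

Lemma fin_supp_scale (V : lmodType K) (k : J -> K) (w : J -> V) :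
  fin_supp k -> fin_supp (fun a => k a *: w a).
Proof. by move=> [F Fk]; exists F => a /Fk ->; rewrite scale0r. Qed.

Let fsm (V : lmodType K) y (w : J -> V) : fin_supp (fun a => (2 * B (d_ a) y) *: w a).
Proof. by apply: fin_supp_scale; have [] := fin_supp_coord Ge Bf xd y. Qed.
Let fsp (V : lmodType K) y (w : J -> V) : fin_supp (fun a => (2 * B y (x_ a)) *: w a).
Proof. by apply: fin_supp_scale; have [] := fin_supp_coord Ge Bf xd y. Qed.

Lemma cm_linear y : linear (cm y).
Proof.
move=> k P Q; rewrite !cmE.
apply: (linear_fsum (f := fun a P => (2 * B (d_ a) y) *: xm a P)) => [a k' P' Q'|P'].
  by rewrite xmL scalerDr !scalerA [_ * k']mulrC.
exact: fsm.
Qed.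

Lemma cp_linear y : linear (cp y).
Proof.
move=> k P Q; rewrite !cpE.
apply: (linear_fsum (f := fun a P => (2 * B y (x_ a)) *: xdv a P)) => [a k' P' Q'|P'].
  by rewrite xdvL scalerDr !scalerA [_ * k']mulrC.
exact: fsp.
Qed.

Definition cliff y P := cm y P + cp y P.
Local Notation c := cliff.

Lemma cliff_linear y : linear (c y).
Proof. by move=> k P Q; rewrite /cliff cm_linear cp_linear scalerDr addrACA. Qed.

Lemma cm_linearl k u v P : cm (k *: u + v) P = k *: cm u P + cm v P.
Proof.
rewrite !cmE -fsumZ; last exact: fsm.
rewrite -fsumD; [|apply: fin_supp_sub (fsm u (fun a => xm a P)) _|exact: fsm].
  by apply: eq_fsum => a; rewrite (formDr Bf) (formZr Bf) mulrDr scalerDl scalerA mulrCA.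
by move=> a ->; rewrite scaler0.
Qed.

Lemma cp_linearl k u v P : cp (k *: u + v) P = k *: cp u P + cp v P.
Proof.
rewrite !cpE -fsumZ; last exact: fsp.
rewrite -fsumD; [|apply: fin_supp_sub (fsp u (fun a => xdv a P)) _|exact: fsp].
  by apply: eq_fsum => a; rewrite (formDl Bf) (formZl Bf) mulrDr scalerDl scalerA mulrCA.
by move=> a ->; rewrite scaler0.
Qed.

Lemma cliff_linearl k u v P : c (k *: u + v) P = k *: c u P + c v P.
Proof. by rewrite /cliff cm_linearl cp_linearl scalerDr addrACA. Qed.

Lemma cliff0l P : c 0 P = 0.
Proof. by have := cliff_linearl (-1) 0 0 P; rewrite scaler0 addr0 scaleN1r addNr. Qed.

Lemma cm_x a P : cm (x_ a) P = xm a P.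
Proof.
rewrite cmE -[RHS](fsum_delta (fun b => xm b P)); apply: eq_fsum => b.
by rewrite (form_dx xd) eq_sym.
Qed.

Lemma cm_d a P : cm (d_ a) P = 0.
Proof. by rewrite cmE; apply: fsum0 => b; rewrite (form_dd Ge Bf xd) mulr0 scale0r. Qed.

Lemma cp_x a P : cp (x_ a) P = 0.
Proof. by rewrite cpE; apply: fsum0 => b; rewrite (form_xx Ge Bf xd) mulr0 scale0r. Qed.

Lemma cp_d a P : cp (d_ a) P = xdv a P.
Proof.
rewrite cpE -[RHS](fsum_delta (fun b => xdv b P)); apply: eq_fsum => b.
by rewrite (form_dx xd).
Qed.

Lemma cliff_x a P : c (x_ a) P = xm a P.
Proof. by rewrite /cliff cm_x cp_x addr0. Qed.

Lemma cliff_d a P : c (d_ a) P = xdv a P.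
Proof. by rewrite /cliff cm_d cp_d add0r. Qed.

(** Both sides are bilinear in [y] and [z]; on pairs of basis vectors the relation is one of the
    Weyl relations. *)
Lemma clifford_relation y z P : homog g true y -> homog g true z ->
  c y (c z P) = c z (c y P) + (2 * B y z) *: P.
Proof.
move=> y1 z1.
pose R y z := c y (c z P) = c z (c y P) + (2 * B y z) *: P.
have SR (z' : g) : subspace [set y | R y z'].
  split=> [|k u v]; rewrite /R /mkset.
    by rewrite !cliff0l (lin0 (cliff_linear _)) (form0l Bf) mulr0 scale0r addr0.
  move=> Ru Rv; rewrite !cliff_linearl cliff_linear Ru Rv (formDl Bf) (formZl Bf).
  by rewrite scalerDr addrACA mulrDr scalerDl scalerA [k * _]mulrCA.
have SR' (y' : g) : subspace [set z | R y' z].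
  split=> [|k u v]; rewrite /R /mkset.
    by rewrite !cliff0l (lin0 (cliff_linear _)) (form0r Bf) mulr0 scale0r addr0.
  move=> Ru Rv; rewrite !cliff_linearl cliff_linear Ru Rv (formDr Bf) (formZr Bf).
  by rewrite scalerDr addrACA mulrDr scalerDl scalerA [k * _]mulrCA.
move: y y1; apply: (odd_ind Ge xd (SR z)) => a; move: z z1;
  apply: (odd_ind Ge xd (SR' _)) => b; rewrite /R /mkset.
- by rewrite !cliff_x (form_xx Ge Bf xd) mulr0 scale0r addr0 xmC.
- by rewrite !cliff_x !cliff_d (form_xd Bf xd) xdv_xm scaleNr addrK.
- by rewrite !cliff_x !cliff_d (form_dx xd) xdv_xm.
- by rewrite !cliff_d (form_dd Ge Bf xd) mulr0 scale0r addr0 xdvC.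
Qed.

Definition nord (y z : g) (P : O) : O :=
  cm y (cm z P) + cm y (cp z P) + cm z (cp y P) + cp y (cp z P).

Lemma nordL y z : linear (nord y z).
Proof.
by do ?apply: linear_add; apply: linear_comp; do ?[exact: cm_linear|exact: cp_linear].
Qed.

(** Normal ordering alters only the product of [cp y] and [cm z], whose factors commute up to a
    scalar. The value of [k] is left open because it cancels in commutators. *)
Lemma nord_cliff y z : homog g true y ->
  exists k, forall P, nord y z P = c y (c z P) - k *: P.
Proof.
move=> y1; suff [k kP] : exists k, forall P, cp y (cm z P) = cm z (cp y P) + k *: P.
  exists k => P; rewrite /nord /cliff !(linD (cm_linear _)) !(linD (cp_linear _)) kP.
  set s := cm y _; set t := cm y _; set u := cm z _; set v := cp y _.
  by rewrite [u + _ + v]addrAC !addrA addrK.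
move: y y1; apply: (odd_ind Ge xd (P := [set y | exists k, _])) => [|a|a].
- split=> [|k u v [ku Hu] [kv Hv]] /=.
    exists 0 => P; rewrite !cpE !fsum0 ?(lin0 (cm_linear _)) ?scale0r ?addr0 // => b;
      by rewrite (form0l Bf) mulr0 scale0r.
  exists (k * ku + kv) => P; rewrite !cp_linearl cm_linear Hu Hv scalerDr addrACA.
  by rewrite scalerDl scalerA.
- by exists 0 => P; rewrite !cp_x (lin0 (cm_linear _)) scale0r addr0.
exists (2 * B (d_ a) z) => P; rewrite !cp_d !cmE (fsum_lin (xdvL a)); last exact: fsm.
rewrite -(fsum_delta (fun b => (2 * B (d_ b) z) *: P) a) -fsumD; first last.
- by exists [fset a]%fset => b; rewrite in_fset1 eq_sym => /negbTE ->; rewrite scale0r.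
- exact: fsm.
apply: eq_fsum => b; rewrite (linZ (xdvL a)) xdv_xm scalerDr !scalerA.
by rewrite [_ * (a == b)%:R]mulrC.
Qed.

(** The commutator with [w] is a derivation of the product of [y] and [z], and [clifford_relation]
    evaluates it on each factor. *)
Lemma cliff_nord y z w P : homog g true y -> homog g true z -> homog g true w ->
  nord y z (c w P) =
  c w (nord y z P) + ((2 * B z w) *: c y P + (2 * B y w) *: c z P).
Proof.
move=> y1 z1 w1; have [k kP] := nord_cliff z y1; rewrite !kP.
rewrite (clifford_relation _ z1 w1) (linD (cliff_linear y)) (clifford_relation _ y1 w1).
rewrite (linZ (cliff_linear y)) (linB (cliff_linear w)) (linZ (cliff_linear w)).
set s := c w (c y _); set t := c w P.
by rewrite [RHS]addrAC [(2 * B z w) *: _ + _]addrC !addrA.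
Qed.

Section EvenElement.
Variable x : g.
Hypothesis x0 : homog g false x.

Let xy1 y : homog g true y -> homog g true [< x, y >].
Proof. by move=> y1; exact: (brk_parity x0 y1). Qed.

Lemma brk_high_degree : exists N : int, forall k y, N <= k ->
  principal e k y -> pos_part e [< x, y >].
Proof.
have PS := subspace_span [set x | exists2 k : int, 0 < k & principal e k x].
apply: (span_min (P := [set x | exists N : int, forall k y, N <= k ->
  principal e k y -> pos_part e [< x, y >]]) _ _ (principal_span Ce x Ge)).
  split=> [|k u v [N HN] [N' HN']].
    by exists 0 => k y _ _; rewrite brk0l; case: PS.
  exists (Num.max N N') => j y; rewrite ge_max => /andP[Nj N'j] jy.
  rewrite brkDl brkZl; have [_ L] := PS.
  by apply: L; [exact: HN jy|exact: HN' jy].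
(* The bound [1 - j <= k] makes the degree [j + k] of the bracket positive. *)
move=> z [j jz]; exists (1 - j) => k y jk ky; apply: sub_span.
by exists (j + k); [lia|exact: principal_brk].
Qed.

(** Almost all [[x, d_a]] stay in the isotropic subspace n^+, so the finite set [F] can be chosen
    uniformly in [b]. *)
Lemma finite_form_brk : exists F : {fset J},
  forall a b, a \notin F -> B (d_ b) [< x, d_ a >] = 0.
Proof.
have [N HN] := brk_high_degree.
have /finite_fsetP [F FE] := finite_low_degree Ge xd N.
exists F => a b aF; have : ~ [set` F] a by exact/negP.
rewrite -FE /= => /contrapT [k Nk ka]; apply: (form_pos Ge Bf).
  by apply: nplus_pos; case: (osc_pos xd b).
exact: HN ka.
Qed.

Lemma fin_supp_minus_brk : exists F : {fset J},
  forall a, a \notin F -> forall P, cm [< x, d_ a >] P = 0.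
Proof.
have [F FP] := finite_form_brk; exists F => a aF P; rewrite cmE.
by apply: fsum0 => b; rewrite FP // mulr0 scale0r.
Qed.

Let form_brk y z : 2 * B [< x, y >] z = - (2 * B y [< x, z >]).
Proof. by rewrite (form_even_inv Bf) // mulrN. Qed.

(** Only the finitely many [b] with [xdv b P] nonzero matter. For each of them the coefficient is,
    by invariance, minus a coordinate of [[x, x_b]], hence nonzero for finitely many [a]. *)
Lemma fin_supp_plus_brk P : fin_supp (fun a => cp [< x, d_ a >] P).
Proof.
have [F FP] := fin_xdv P.
have /choice [G GP] b : exists G : {fset J}, forall a, a \notin G ->
    2 * B [< x, d_ a >] (x_ b) = 0.
  have [[G GP] _] := fin_supp_coord Ge Bf xd [< x, x_ b >].
  by exists G => a /GP; rewrite form_brk => ->; rewrite oppr0.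
exists (\bigcup_(b <- F) G b)%fset => a aG; rewrite cpE; apply: fsum0 => b.
case: (boolP (b \in F)) => [bF|/FP ->]; last by rewrite scaler0.
rewrite GP ?scale0r //; apply: contra aG.
by apply/fsubsetP/bigfcup_sup.
Qed.

Lemma fin_supp_nord_d P : fin_supp (fun a => nord [< x, x_ a >] (d_ a) P).
Proof.
apply: fin_supp_sub (fin_xdv P) _ => a aP.
by rewrite /nord !cm_d !cp_d aP (lin0 (cm_linear _)) (lin0 (cp_linear _)) !addr0.
Qed.

(** Normal ordering is decisive here: it puts [cp [x, d_a]] to the right of [x_a], so that it acts
    on [P] itself and gives 0 for almost all [a]. *)
Lemma fin_supp_nord_x P : fin_supp (fun a => nord [< x, d_ a >] (x_ a) P).
Proof.
have [F Fm] := fin_supp_minus_brk; have [G Gp] := fin_supp_plus_brk P.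
exists (F `|` G)%fset => a; rewrite in_fsetU negb_or => /andP[/Fm aF /Gp aG].
by rewrite /nord !aF !cp_x aG (lin0 (cm_linear _)) (lin0 (cp_linear _)) !addr0.
Qed.

Variable r : K.

Definition osc P : O :=
  2^-1 *: \sum_(a \in [set: J]) nord [< x, x_ a >] (d_ a) P
  - 2^-1 *: \sum_(a \in [set: J]) nord [< x, d_ a >] (x_ a) P
  - r *: P.

Lemma oscL : linear osc.
Proof.
apply: linear_sub; last by apply: linear_scale => k P Q.
by apply: linear_sub; apply: linear_scale; apply: linear_fsum => [a|P];
  [exact: nordL|exact: fin_supp_nord_d|exact: nordL|exact: fin_supp_nord_x].
Qed.

(* Commuting with the Clifford product y z gives 2B(z, w) y + 2B(y, w) z; summed
   over the dual bases, each of the two terms contributes half of [x, w]. *)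
Lemma osc_cliff w P : homog g true w ->
  osc (c w P) = c w (osc P) + c [< x, w >] P.
Proof.
move=> w1.
pose S3 := \sum_(a \in [set: J]) (2 * B (d_ a) w) *: c [< x, x_ a >] P.
pose S4 := \sum_(a \in [set: J]) (2 * B w (x_ a)) *: c [< x, d_ a >] P.
have E1 : \sum_(a \in [set: J]) nord [< x, x_ a >] (d_ a) (c w P) =
    c w (\sum_(a \in [set: J]) nord [< x, x_ a >] (d_ a) P)
    + (S3 + cp [< x, w >] P).
  have fN := fin_supp_lin (cliff_linear w) (fin_supp_nord_d P).
  have f1 := fsm w (fun a => c [< x, x_ a >] P).
  have f2 := fsp [< x, w >] (fun a => xdv a P).
  rewrite (fsum_lin (cliff_linear w) (fin_supp_nord_d P)) cpE.
  rewrite -(fsumD f1 f2) -(fsumD fN (fin_suppD f1 f2)).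
  apply: eq_fsum => a; rewrite cliff_nord //; last exact: xy1.
  by rewrite form_brk (form_odd_odd Bf (x1 a) (xy1 w1)) mulrN opprK cliff_d.
have E2 : \sum_(a \in [set: J]) nord [< x, d_ a >] (x_ a) (c w P) =
    c w (\sum_(a \in [set: J]) nord [< x, d_ a >] (x_ a) P)
    - (S4 + cm [< x, w >] P).
  have fN := fin_supp_lin (cliff_linear w) (fin_supp_nord_x P).
  have f1 := fsp w (fun a => c [< x, d_ a >] P).
  have f2 := fsm [< x, w >] (fun a => xm a P).
  rewrite (fsum_lin (cliff_linear w) (fin_supp_nord_x P)) cmE.
  rewrite -(fsumD f1 f2) -(fsumB fN (fin_suppD f1 f2)).
  apply: eq_fsum => a; rewrite cliff_nord //; last exact: xy1.
  by rewrite form_brk (form_odd_odd Bf (x1 a) w1) mulrN !scaleNr cliff_x opprD.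
have E3 : c [< x, w >] P = S3 + S4.
  apply: (odd_expansion Ge Bf xd (f := fun y => c [< x, y >] P) _ w1).
  by move=> k u v; rewrite brkDr brkZr cliff_linearl.
(* [S3 + S4] expands [w] before applying [ad x], while [cm + cp] expands [[x, w]]; both equal [c
   [x, w] P], which accounts for the factor 1/2. *)
have half : c [< x, w >] P = 2^-1 *: (S3 + cp [< x, w >] P + (S4 + cm [< x, w >] P)).
  rewrite addrACA -E3 [cp _ _ + _]addrC -/(cliff _ _) -mulr2n -scaler_nat scalerA.
  by rewrite mulVf ?scale1r // pnatr_eq0.
rewrite /osc E1 E2 !(linB (cliff_linear w)) !(linZ (cliff_linear w)) half.
move: (S3 + _) (S4 + _) => T3 T4.
rewrite scalerDr scalerBr (scalerDr _ T3 T4) opprB.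
rewrite [RHS]addrAC addrA.
by rewrite [X in _ = X - _]addrAC !addrA.
Qed.
End EvenElement.
End Clifford.

(** * The relative Dirac operator *)

Section Modules.
Variables (K : fieldType) (g : lieSuperalg K) (M : supermodule g).

Lemma actL (y : g) : linear (act y : M -> M).
Proof. by have [H _] := act_bilinear M. Qed.
Lemma actR (v : M) : linear (fun y : g => act y v).
Proof. by have [_ H] := act_bilinear M. Qed.

Lemma act_even (x y : g) (v : M) : homog g false x ->
  act [< x, y >] v = act x (act y v) - act y (act x v).
Proof.
move=> x0; move: y; apply: homog_ind => [|b y yb].
  split=> [|k y z] /=.
    by rewrite brk0r !(lin0 (actR _)) (lin0 (actL _)) subr0.
  rewrite brkDr brkZr !(linD (actR _)) !(linZ (actR _)) => -> ->.
  by rewrite (linD (actL x)) (linZ (actL x)) scalerBr opprD addrACA.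
by rewrite (act_brk v x0 yb) scale1r.
Qed.

Lemma part_act_even (x : g) b (v : M) : homog g false x ->
  part b (act x v) = act x (part b v).
Proof.
move=> x0; rewrite -{1}(part_sum v) (linD (actL x)) (linD (part_linear b)).
have E c : part b (act x (part c v)) = if b == c then act x (part c v) else 0.
  by apply: part_homog; apply: (act_parity x0 (homog_part c v)).
by rewrite (E false) (E true); case: b {E}; rewrite /= ?add0r ?addr0.
Qed.

Lemma parity_sign_linear : linear (@parity_sign K M).
Proof. by apply: linear_sub; exact: part_linear. Qed.

Lemma parity_sign_act (x : g) (v : M) : homog g false x ->
  parity_sign (act x v) = act x (parity_sign v).
Proof.
by move=> x0; rewrite /parity_sign !part_act_even // (linB (actL x)).
Qed.
End Modules.

(** * Local nilpotency on a highest weight module *)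

Section HighestWeight.
Variables (K : fieldType) (n : nat) (A : 'M[K]_n) (p : 'I_n -> bool).
Variables (h : realization A) (g : lieSuperalg K) (e : generators h g).
Hypothesis Ge : contragredient p e.
Variable M : supermodule g.
Hypothesis HM : highest_weight e M.

Let Ce := contragredient_chevalley Ge.

(* The vectors killed in all high degrees form a submodule, which contains the
   highest weight vector. *)
Lemma highest_weight_locally_nilpotent (v : M) : exists N : int,
  forall k y, N <= k -> principal e k y -> act y v = 0.
Proof.
pose S := [set v : M | exists N : int,
  forall k y, N <= k -> principal e k y -> act y v = 0].
have SS : subspace S.
  split=> [|k u w [N HN] [N' HN']].
    by exists 0 => k y _ _; rewrite (lin0 (actL y)).
  exists (Num.max N N') => j y; rewrite ge_max => /andP[Nj N'j] jy.
  by rewrite (actL y) (HN _ _ Nj jy) (HN' _ _ N'j jy) scaler0 addr0.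
have [_ _ [L [vL [_ _ vL0 vLS]]]] := HM.
suff ST : S = setT by have : S v by rewrite ST.
apply: vLS => //; last first.
  by exists 1 => k y k1 ky; apply: vL0; apply: (principal_nplus Ce _ ky); lia.
move=> x; apply: (span_min (P := [set x | forall w, S w -> S (act x w)]) _ _
  (principal_span Ce x Ge)).
  split=> [w _|k y z Hy Hz w Sw].
    by rewrite (lin0 (actR w)); case: SS.
  by rewrite (actR w k y z); have [_ L2] := SS; apply: L2; [exact: Hy|exact: Hz].
(* On homogeneous parts [yx = [y, x] ± xy], so [yx] kills [w] once both [k] and [k + j] are at least
   [N]. *)
move=> {}x [j jx] w [N HN]; exists (Num.max N (N - j)) => k y.
rewrite ge_max => /andP[Nk Nk'] ky.
have E b c : act (part b y) (act (part c x) w) = 0.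
  have yb := principal_part Ce b ky; have xc := principal_part Ce c jx.
  have := act_brk w (homog_part b y) (homog_part c x).
  rewrite (HN _ _ _ (principal_brk yb xc)); last by lia.
  by rewrite (HN _ _ Nk yb) (lin0 (actL _)) scaler0 subr0.
rewrite -(part_sum y) -(part_sum x) (linD (actR _)) (linD (actR w)).
by rewrite !(linD (actL _)) !E !addr0.
Qed.
End HighestWeight.

Section Dirac.
Variables (K : numFieldType) (n : nat) (A : 'M[K]_n) (p : 'I_n -> bool).
Variables (h : realization A) (g : lieSuperalg K) (e : generators h g).
Variables (d : 'rV[K]_n) (B : g -> g -> K).
Variables (J : choiceType) (x_ d_ : J -> g).
Hypotheses (Ge : contragredient p e) (Bf : standard_form e d B).
Hypothesis xd : oscillator_bases e B x_ d_.

Variables (O : lmodType K) (xm xdv : J -> O -> O) (cm cp : g -> O -> O).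
Hypotheses (xmL : forall a, linear (xm a)) (xdvL : forall a, linear (xdv a)).
Hypothesis xmC : forall a b P, xm a (xm b P) = xm b (xm a P).
Hypothesis xdvC : forall a b P, xdv a (xdv b P) = xdv b (xdv a P).
Hypothesis xdv_xm : forall a b P,
  xdv a (xm b P) = xm b (xdv a P) + (a == b)%:R *: P.
Hypothesis fin_xdv : forall P, fin_supp (fun a => xdv a P).
Hypothesis cmE : forall y P,
  cm y P = \sum_(a \in [set: J]) (2 * B (d_ a) y) *: xm a P.
Hypothesis cpE : forall y P,
  cp y P = \sum_(a \in [set: J]) (2 * B y (x_ a)) *: xdv a P.

Variable M : supermodule g.
Hypothesis HM : highest_weight e M.
Variable T : tensor_product M O.

Let Ce := contragredient_chevalley Ge.
Let x1 a : homog g true (x_ a). Proof. by case: (osc_neg xd a). Qed.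
Let d1 a : homog g true (d_ a). Proof. by case: (osc_pos xd a). Qed.

Local Notation c := (cliff cm cp).
Let cliffL := cliff_linear Ge Bf xd xmL xdvL cmE cpE.
Let cliffLl := cliff_linearl Ge Bf xd cmE cpE.
Let cliff_d' := cliff_d Ge Bf xd cmE cpE.
Let tensL (v : M) : linear (tens T v). Proof. by have [] := tens_bilinear T. Qed.
Let tensR (P : O) : linear (fun v : M => tens T v P).
Proof. by have [] := tens_bilinear T. Qed.

Lemma fin_supp_act_d (v : M) : fin_supp (fun a => act (d_ a) v).
Proof.
have [N HN] := highest_weight_locally_nilpotent Ge HM v.
apply: finite_fin_supp (finite_low_degree Ge xd N) _ => a /= /contrapT [k Nk ka].
exact: HN ka.
Qed.

Lemma fin_supp_c_d P : fin_supp (fun a => c (d_ a) P).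
Proof. by apply: fin_supp_sub (fin_xdv P) _ => a; rewrite cliff_d'. Qed.

(* ad x annihilates the canonical element sum_a (x_a (x) d_a - d_a (x) x_a).
   The matrix entries of ad x cancel in pairs after exchanging a and b, which is
   legitimate because in each double sum one index ranges over a finite set
   and the rows of the matrices are finite. *)
Lemma invariant_sum (x : g) (v : M) (P : O) : homog g false x ->
  \sum_(a \in [set: J])
    (tens T (act [< x, x_ a >] v) (c (d_ a) P)
     + tens T (act (x_ a) v) (c [< x, d_ a >] P)
     - (tens T (act [< x, d_ a >] v) (c (x_ a) P)
        + tens T (act (d_ a) v) (c [< x, x_ a >] P))) = 0.
Proof.
move=> x0.
(* [f1] and [f4] carry the n^- coordinates of [[x, x_a]], [f2] its n^+ coordinates, [f3] the n^-
   coordinates of [[x, d_a]]. The n^+ coordinates of [[x, d_a]] are by invariance minus the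
   transpose of the first matrix, hence need no family of their own. *)
pose f1 a b := (2 * B (d_ b) [< x, x_ a >]) *: tens T (act (x_ b) v) (c (d_ a) P).
pose f2 a b := (2 * B [< x, x_ a >] (x_ b)) *: tens T (act (d_ b) v) (c (d_ a) P).
pose f3 a b := (2 * B (d_ b) [< x, d_ a >]) *: tens T (act (x_ a) v) (c (x_ b) P).
pose f4 a b := (2 * B (d_ b) [< x, x_ a >]) *: tens T (act (d_ a) v) (c (x_ b) P).
have fsm y (w : J -> T) : fin_supp (fun b => (2 * B (d_ b) y) *: w b).
  by apply: fin_supp_scale; have [] := fin_supp_coord Ge Bf xd y.
have fsp y (w : J -> T) : fin_supp (fun b => (2 * B y (x_ b)) *: w b).
  by apply: fin_supp_scale; have [] := fin_supp_coord Ge Bf xd y.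
have [Fd FdP] := fin_supp_c_d P; have [Fn FnP] := fin_supp_act_d v.
have [Fr FrP] := finite_form_brk Ge Bf xd x.
have form_brk y z : 2 * B [< x, y >] z = - (2 * B y [< x, z >]).
  by rewrite (form_even_inv Bf) // mulrN.
have xy1 y : homog g true y -> homog g true [< x, y >] by exact: brk_parity x0.
(* [B] is antisymmetric on odd elements and [ad x] is skew for it, so the blocks of [ad x] that
   exchange n^- and n^+ are symmetric matrices. *)
have sym_x a b : 2 * B [< x, x_ a >] (x_ b) = 2 * B [< x, x_ b >] (x_ a).
  by rewrite form_brk (form_odd_odd Bf (x1 a) (xy1 _ (x1 b))) mulrN opprK.
have sym_d a b : 2 * B (d_ a) [< x, d_ b >] = 2 * B (d_ b) [< x, d_ a >].
  by rewrite -[LHS]opprK -form_brk (form_odd_odd Bf (xy1 _ (d1 a)) (d1 b)) mulrN opprK.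
(* Rows of [f1] and [f2] vanish when [d_a] kills [P], those of [f3] when [[x, d_a]] has no n^- part,
   those of [f4] when [d_a] kills [v]. *)
have z1 a b : a \notin Fd -> f1 a b = 0.
  by move=> /FdP aF; rewrite /f1 aF (lin0 (tensL _)) scaler0.
have z2 a b : a \notin Fd -> f2 a b = 0.
  by move=> /FdP aF; rewrite /f2 aF (lin0 (tensL _)) scaler0.
have z3 a b : a \notin Fr -> f3 a b = 0.
  by move=> aF; rewrite /f3 FrP // mulr0 scale0r.
have z4 a b : a \notin Fn -> f4 a b = 0.
  by move=> /FnP aF; rewrite /f4 aF (lin0 (tensR _)) scaler0.
have [s1 t1 e1] := exchange_fsum z1 (fun a => fsm _ _).
have [s2 t2 e2] := exchange_fsum z2 (fun a => fsp _ _).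
have [s3 t3 e3] := exchange_fsum z3 (fun a => fsm _ _).
have [s4 t4 e4] := exchange_fsum z4 (fun a => fsm _ _).
have E1 a : tens T (act [< x, x_ a >] v) (c (d_ a) P) =
    \sum_(b \in [set: J]) f1 a b + \sum_(b \in [set: J]) f2 a b.
  apply: (odd_expansion Ge Bf xd (f := fun y => tens T (act y v) (c (d_ a) P))).
    exact: (linear_comp (tensR _) (actR v)).
  exact: xy1.
have E2 a : tens T (act (x_ a) v) (c [< x, d_ a >] P) =
    \sum_(b \in [set: J]) f3 a b - \sum_(b \in [set: J]) f1 b a.
  rewrite -fsumN; last by exists Fd => b; exact: z1.
  rewrite (odd_expansion Ge Bf xd (f := fun y => tens T (act (x_ a) v) (c y P))) //.
  - by congr (_ + _); apply: eq_fsum => b; rewrite form_brk scaleNr.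
  - by apply: (linear_comp (tensL _)) => k y z; exact: cliffLl.
  - exact: xy1.
have E3 a : tens T (act [< x, d_ a >] v) (c (x_ a) P) =
    \sum_(b \in [set: J]) f3 b a - \sum_(b \in [set: J]) f4 b a.
  rewrite -fsumN; last by exists Fn => b; exact: z4.
  rewrite (odd_expansion Ge Bf xd (f := fun y => tens T (act y v) (c (x_ a) P))).
  - congr (_ + _); apply: eq_fsum => b; first by rewrite sym_d.
    by rewrite form_brk scaleNr.
  - exact: (linear_comp (tensR _) (actR v)).
  - exact: xy1.
have E4 a : tens T (act (d_ a) v) (c [< x, x_ a >] P) =
    \sum_(b \in [set: J]) f4 a b + \sum_(b \in [set: J]) f2 b a.
  rewrite (odd_expansion Ge Bf xd (f := fun y => tens T (act (d_ a) v) (c y P))).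
  - by congr (_ + _); apply: eq_fsum => b; rewrite sym_x.
  - by apply: (linear_comp (tensL _)) => k y z; exact: cliffLl.
  - exact: xy1.
under eq_fsum do rewrite E1 E2 E3 E4.
have u1 := fin_suppD s1 s2; have u2 := fin_suppB s3 t1.
have u3 := fin_suppB t3 t4; have u4 := fin_suppD s4 t2.
rewrite (fsumB (fin_suppD u1 u2) (fin_suppD u3 u4)) (fsumD u1 u2) (fsumD u3 u4).
rewrite (fsumD s1 s2) (fsumB s3 t1) (fsumB t3 t4) (fsumD s4 t2) e1 e2 e3 e4.
by rewrite [X in X - _]addrC !addrA !subrK subrr.
Qed.

Definition tens_cliff (y z : g) : T -> T :=
  tens_lift (fun v P => tens T (act y (parity_sign v)) (c z P)).

Lemma tens_cliffP y z : linear (tens_cliff y z) /\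
  forall v P, tens_cliff y z (tens T v P) = tens T (act y (parity_sign v)) (c z P).
Proof.
apply: (@tens_liftP _ _ _ T _ (fun v P => tens T (act y (parity_sign v)) (c z P))).
split=> [v|P]; first exact: (linear_comp (tensL _) (cliffL z)).
apply: (linear_comp (tensR _)).
exact: (linear_comp (actL y) (@parity_sign_linear _ _ M)).
Qed.

Let tens_cliffL y z := proj1 (tens_cliffP y z).
Let tens_cliffE y z := proj2 (tens_cliffP y z).

Definition dirac_op (t : T) : T :=
  2 *: \sum_(a \in [set: J]) (tens_cliff (x_ a) (d_ a) t - tens_cliff (d_ a) (x_ a) t).

Lemma fin_supp_cliff_xd v P : fin_supp (fun a => tens T (act (x_ a) v) (c (d_ a) P)).
Proof. by apply: fin_supp_sub (fin_supp_c_d P) _ => a ->; rewrite (lin0 (tensL _)). Qed.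

Lemma fin_supp_cliff_dx v P : fin_supp (fun a => tens T (act (d_ a) v) (c (x_ a) P)).
Proof. by apply: fin_supp_sub (fin_supp_act_d v) _ => a ->; rewrite (lin0 (tensR _)). Qed.

Lemma dirac_op_linear : linear dirac_op.
Proof.
apply: linear_scale; apply: linear_fsum => [a|]; first exact: linear_sub.
apply: tens_fin_supp => [a|v P]; first exact: linear_sub.
apply: (fin_supp_sub (f := fun a => tens T (act (x_ a) (parity_sign v)) (c (d_ a) P)
  - tens T (act (d_ a) (parity_sign v)) (c (x_ a) P))); last by move=> a; rewrite !tens_cliffE.
by apply: fin_suppB; [exact: fin_supp_cliff_xd|exact: fin_supp_cliff_dx].
Qed.

Lemma dirac_op_tens v P : dirac_op (tens T v P) =
  2 *: \sum_(a \in [set: J]) (tens T (act (x_ a) (parity_sign v)) (c (d_ a) P)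
                             - tens T (act (d_ a) (parity_sign v)) (c (x_ a) P)).
Proof. by congr (_ *: _); apply: eq_fsum => a; rewrite !tens_cliffE. Qed.

Section Diagonal.
Variables (x : g) (r : K).
Hypothesis x0 : homog g false x.
Local Notation osc := (osc x_ d_ cm cp x r).

Definition diag_op : T -> T :=
  tens_lift (fun v P => tens T (act x v) P + tens T v (osc P)).

Lemma diag_opP : linear diag_op /\
  forall v P, diag_op (tens T v P) = tens T (act x v) P + tens T v (osc P).
Proof.
apply: (@tens_liftP _ _ _ T _ (fun v P => tens T (act x v) P + tens T v (osc P))).
split=> [v|P]; apply: linear_add; first exact: tensL; last exact: tensR;
  last exact: (linear_comp (tensR _) (actL x)).
apply: (linear_comp (tensL v)).
exact: (oscL Ge Bf xd xmL xdvL fin_xdv cmE cpE x0 r).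
Qed.

Lemma diag_op_linear : linear diag_op. Proof. by have [] := diag_opP. Qed.

Let diagL := diag_op_linear.
Let diagE := proj2 diag_opP.

(** On a pure tensor the commutator is, up to a factor, the sum of [invariant_sum] at
    [w = parity_sign v]: the sign map commutes with the even [x], so it merely replaces [v] by
    [w]. *)
Lemma dirac_op_diag t : dirac_op (diag_op t) = diag_op (dirac_op t).
Proof.
have oscC w P : homog g true w -> osc (c w P) = c w (osc P) + c [< x, w >] P.
  exact: (osc_cliff Ge Bf xd xmL xdvL xmC xdvC xdv_xm fin_xdv cmE cpE x0 r).
move: t; apply: tens_ext => [||v P].
- exact: (linear_comp dirac_op_linear diagL).
- exact: (linear_comp diagL dirac_op_linear).
rewrite diagE (linD dirac_op_linear) !dirac_op_tens (linZ diagL) -scalerDr.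
rewrite parity_sign_act //; set w := parity_sign v.
have s1 := fin_supp_cliff_xd (act x w) P; have s2 := fin_supp_cliff_dx (act x w) P.
have s3 := fin_supp_cliff_xd w (osc P); have s4 := fin_supp_cliff_dx w (osc P).
have s5 := fin_supp_cliff_xd w P; have s6 := fin_supp_cliff_dx w P.
congr (_ *: _); rewrite -(fsumD (fin_suppB s1 s2) (fin_suppB s3 s4)).
rewrite (fsum_lin diagL (fin_suppB s5 s6)).
apply/eqP; rewrite -subr_eq0 -oppr_eq0 opprB -fsumB; last first.
- by apply: fin_suppD; exact: fin_suppB.
- exact: (fin_supp_lin diagL (fin_suppB s5 s6)).
apply/eqP; rewrite -[RHS](invariant_sum w P x0); apply: eq_fsum => a.
have tC u y : homog g true y -> tens T u (osc (c y P)) =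
    tens T u (c y (osc P)) + tens T u (c [< x, y >] P).
  by move=> y1; rewrite oscC // (linD (tensL u)).
have tA y Q : tens T (act [< x, y >] w) Q =
    tens T (act x (act y w)) Q - tens T (act y (act x w)) Q.
  by rewrite act_even // (linB (tensR Q)).
rewrite (linB diagL) !diagE !tC // !tA !opprD !opprK !addrA.
(* The two bracketed pairs are the terms containing [osc P]; they cancel. *)
by rewrite [LHS](ACl (1*7*3*4*8*6*(2*9)*(5*10))%AC) /= subrr addNr !addr0.
Qed.
End Diagonal.
End Dirac.

Theorem lemma84 (R : realType) (n : nat) (A : 'M[R[i]]_n) (p : 'I_n -> bool)
  (h : realization A) (g : lieSuperalg R[i]) (e : generators h g)
  (d : 'rV[R[i]]_n) (B : g -> g -> R[i])
  (rho rho0 : 'Hom(h, (R[i])^o))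
  (J : choiceType) (x_ d_ : J -> g)
  (M : supermodule g) (T : tensor_product M (oscillator R[i] J)) :
  kac_moody p e ->
  symmetrized_by A d ->
  standard_form e d B ->
  (forall i j, dual_form e B (alpha h i) (alpha h j) \is Num.real) ->
  weyl_vector rho ->
  kac_peterson_trivialized_by e rho0 ->
  oscillator_bases e B x_ d_ ->
  highest_weight e M ->
  let ker_dirac := [set t : T | dirac B x_ d_ t = 0] in
  subspace ker_dirac /\
  forall x, homog g false x -> forall t, ker_dirac t ->
    ker_dirac (diag_act e B x_ d_ (rho0 - rho) x t).
Proof.
move=> [_ Ge _ _ _] _ Bf _ _ _ xd HM.
(* For the concrete Clifford action the equations defining [cm] and [cp] hold by reflexivity, so the
   results on the abstract module apply up to conversion. *)
have cmE := fun y (P : oscillator R[i] J) => erefl (cl_minus B d_ y P).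
have cpE := fun y (P : oscillator R[i] J) => erefl (cl_plus B x_ y P).
have DL : linear (fun t : T => dirac B x_ d_ t).
  exact (dirac_op_linear (T := T) Ge Bf xd (@xmul_linear _ J)
    (@xderiv_linear _ J) (@fin_supp_xderiv _ J) cmE cpE HM).
have GL x : homog g false x ->
    linear (fun t : T => diag_act e B x_ d_ (rho0 - rho) x t).
  move=> x0.
  exact (diag_op_linear (T := T) Ge Bf xd (@xmul_linear _ J)
    (@xderiv_linear _ J) (@fin_supp_xderiv _ J) cmE cpE
    (ext0 e (rho0 - rho) x) x0).
have DC x : homog g false x -> forall t : T,
    dirac B x_ d_ (diag_act e B x_ d_ (rho0 - rho) x t) =
    diag_act e B x_ d_ (rho0 - rho) x (dirac B x_ d_ t).
  move=> x0 t.
  exact (dirac_op_diag (T := T) Ge Bf xd (@xmul_linear _ J)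
    (@xderiv_linear _ J) (@xmulC _ J) (@xderivC _ J) (@xderiv_xmul _ J)
    (@fin_supp_xderiv _ J) cmE cpE HM (ext0 e (rho0 - rho) x) x0 t).
split; first exact: (preimage_subspace (S := [set 0]) DL (subspace_zero T)).
move=> x x0 t Dt; rewrite /mkset (DC x x0) (_ : dirac B x_ d_ t = 0) //.
exact: (lin0 (GL x x0)).
Qed.
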